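(* Let $s\in[0,1]$, $N\in\frac12\mathbb Z$, $N\neq 0$, and let $(\lambda_l)_{l\in|N|+\mathbb N}$ be a divergent sequence of positive numbers. If $\lambda_{l+1}-\lambda_l$ is a bounded sequence, then $(\mathcal A(S^2_{qs}),\mathcal H,D_\lambda,\gamma)$ is a regular even spectral triple.
   Context: Fix $0<q<1$; $[x]=(q^x-q^{-x})/(q-q^{-1})$. For $0\le s\le1$, $\mathcal A(S^2_{qs})$ is the unital $*$-algebra generated by $A=A^*,B,B^*$ with relations $AB=q^2BA$, $BB^*+(A+s^2)(A-1)=0$, $B^*B+(q^2A+s^2)(q^2A-1)=0$ (Podle\'s sphere). For nonzero $M\in\frac12\mathbb Z$ let $\mathcal H_M$ be the Hilbert space with orthonormal basis $|l,m;M\rangle$, $l-|M|\in\mathbb N$, $m\in\{-l,-l+1,\dots,l\}$. Put $x_1=(q[2])^{1/2}B$, $x_0=1-s^2-q[2]A$. The $*$-representation of $\mathcal A(S^2_{qs})$ on $\mathcal H_M$ is $$x_1|l,m;M\rangle=q^{-l+m}\sqrt{[l+m+1][l+m+2]}\,\alpha_{M,l+1}|l+1,m+1;M\rangle-q^{m+2}\sqrt{[2][l-m][l+m+1]}\,\beta_{M,l}|l,m+1;M\rangle-q^{l+m+1}\sqrt{[l-m][l-m-1]}\,\alpha_{M,l}|l-1,m+1;M\rangle,$$ $$x_0|l,m;M\rangle=q^m\sqrt{[2][l-m+1][l+m+1]}\,\alpha_{M,l+1}|l+1,m;M\rangle+\big([2l]-q^{l+m+1}[2][l-m]\big)\beta_{M,l}|l,m;M\rangle+q^m\sqrt{[2][l-m][l+m]}\,\alpha_{M,l}|l-1,m;M\rangle,$$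 with terms involving vectors outside the index set omitted, where $$\alpha_{M,l}=\frac1{[2l]}\sqrt{\frac{[2][l+M][l-M]}{[2l-1][2l+1]}}\sqrt{(q^{l+M}+q^{-(l+M)}s^2)(q^{l-M}s^2+q^{-(l-M)})},$$ $$\beta_{M,l}=\frac{([2l]-q^{l+M+1}[2][l-M])(1-s^2)+q[2][2M]s^2}{q^2[2l][2l+2]}.$$ Fix $N\in\frac12\mathbb Z$, $N\ne0$. Let $\mathcal H=\mathcal H_{-N}\oplus\mathcal H_N$, let $\gamma=+1$ on $\mathcal H_{-N}$ and $-1$ on $\mathcal H_N$. The operator $D_\lambda$ is the self-adjoint operator on $\mathcal H$ determined by $D_\lambda|l,m;\pm N\rangle=\lambda_l|l,m;\mp N\rangle$. A spectral triple $(\mathcal A,\mathcal H,D)$ consists of a $*$-representation of a unital $*$-algebra $\mathcal A$ by bounded operators on $\mathcal H$ and a self-adjoint $D$ with $(D+i)^{-1}$ compact and $[D,a]$ bounded for all $a\in\mathcal A$. It is even with grading $\gamma$ if $\gamma=\gamma^*$, $\gamma^2=1$, $\gamma D=-D\gamma$, $\gamma a=a\gamma$. With $\delta(T)=[|D|,T]$ and $\mathrm{OP}^0=\bigcap_{j\ge0}\mathrm{dom}\,\delta^j$, it is regular if $\mathcal A\cup[D,\mathcal A]\subset\mathrm{OP}^0$. *)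

(* Defs.v *)
(* Operators on complex Hilbert spaces, spectral triples, the *-algebra of the
   Podles sphere and its representations, over MathComp-Analysis. *)
From HB Require Import structures.
From mathcomp Require Import all_boot all_order all_algebra.
From mathcomp Require Import generic_quotient.
From mathcomp Require Import complex.
From mathcomp Require Import all_classical all_reals.
From mathcomp Require Import topology normedtype sequences exp.

Set Implicit Arguments.
Unset Strict Implicit.
Unset Printing Implicit Defensive.

Import Order.TTheory GRing.Theory Num.Theory.
Import numFieldNormedType.Exports.

Local Open Scope classical_set_scope.
Local Open Scope ring_scope.
Local Open Scope quotient_scope.

(* Unital *-algebras. *)

HB.mixin Record isStarAlgebra (C : numClosedFieldType) A of GRing.Algebra C A :=
  { star : A -> A;
    starK : forall x, star (star x) = x;
    starD : forall x y, star (x + y) = star x + star y;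
    starM : forall x y, star (x * y) = star y * star x;
    starZ : forall (c : C) x, star (c *: x) = c^* *: star x }.

#[short(type="starAlgType")]
HB.structure Definition StarAlgebra (C : numClosedFieldType) :=
  { A of GRing.Algebra C A & isStarAlgebra C A }.

(* Hilbert spaces; the inner product is linear in its second argument. *)

HB.mixin Record isHilbert (C : numClosedFieldType) H of CompleteNormedModule C H :=
  { inner : H -> H -> C;
    innerDr : forall x y z, inner x (y + z) = inner x y + inner x z;
    innerZr : forall (c : C) x y, inner x (c *: y) = c * inner x y;
    inner_conj : forall x y, inner y x = (inner x y)^*;
    inner_norm : forall x, inner x x = `|x| ^+ 2 }.

#[short(type="hilbertType")]
HB.structure Definition Hilbert (C : numClosedFieldType) :=
  { H of CompleteNormedModule C H & isHilbert C H }.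

Section Operators.
Context (C : numClosedFieldType) (H : hilbertType C).

Definition linear_span (E : set H) : set H :=
  [set x | exists (n : nat) (c : 'I_n -> C) (v : 'I_n -> H),
     (forall k, E (v k)) /\ x = \sum_(k < n) c k *: v k].

Definition orthonormal_basis (T : choiceType) (I : set T) (e : T -> H) : Prop :=
  (forall i j, I i -> I j -> inner (e i) (e j) = (i == j)%:R) /\
  dense (linear_span (e @` I)).

Definition bounded_op (T : H -> H) : Prop :=
  linear T /\ exists K : C, forall x, `|T x| <= K * `|x|.

Definition compact_op (T : H -> H) : Prop :=
  linear T /\ compact (closure (T @` [set x | `|x| <= 1])).

(* An unbounded operator D is represented by its graph: [D (x, y)] means that
   x is in the domain of D and that D x = y. *)
Definition domain (D : set (H * H)) : set H := fst @` D.

Definition adjoint (D : set (H * H)) : set (H * H) :=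
  [set p | forall x y, D (x, y) -> inner p.2 x = inner p.1 y].

(* Density of the domain makes [adjoint D] the graph of a linear operator. *)
Definition self_adjoint (D : set (H * H)) : Prop :=
  dense (domain D) /\ adjoint D = D.

Definition positive_op (D : set (H * H)) : Prop :=
  forall x y, D (x, y) -> 0 <= inner x y.

Definition comp_op (D E : set (H * H)) : set (H * H) :=
  [set p | exists2 y, E (p.1, y) & D (y, p.2)].

(* P = |D| = (D^* D)^(1/2), the positive self-adjoint square root of D^* D. *)
Definition is_abs_op (D P : set (H * H)) : Prop :=
  [/\ self_adjoint P, positive_op P & comp_op P P = comp_op (adjoint D) D].

(* T maps the domain of D into itself, and S is the bounded operator extending
   [D, T] = D T - T D. *)
Definition is_commutator (D : set (H * H)) (T S : H -> H) : Prop :=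
  bounded_op S /\ forall x y, D (x, y) -> D (T x, T y + S x).

(* K = (D + i)^-1. *)
Definition is_resolvent (D : set (H * H)) (K : H -> H) : Prop :=
  forall x z, K z = x <-> exists2 y, D (x, y) & y + 'i *: x = z.

(* T is in dom (delta^j), where delta = [P, _]. *)
Fixpoint dom_delta (P : set (H * H)) (j : nat) (T : H -> H) : Prop :=
  bounded_op T /\
  if j is j'.+1 then exists2 S, is_commutator P T S & dom_delta P j' S
  else True.

Definition OP0 (P : set (H * H)) (T : H -> H) : Prop :=
  forall j, dom_delta P j T.

Context (A : starAlgType C).

(* Boundedness of the operators is required separately in [spectral_triple]. *)
Definition star_representation (pi : A -> H -> H) : Prop :=
  [/\ (forall a, linear (pi a)),
      (forall (c : C) a b x, pi (c *: a + b) x = c *: pi a x + pi b x),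
      (forall x, pi 1 x = x),
      (forall a b x, pi (a * b) x = pi a (pi b x)) &
      (forall a x y, inner (pi (star a) x) y = inner x (pi a y))].

Definition spectral_triple (pi : A -> H -> H) (D : set (H * H)) : Prop :=
  [/\ star_representation pi,
      (forall a, bounded_op (pi a)),
      self_adjoint D,
      (exists2 K, is_resolvent D K & compact_op K) &
      (forall a, exists S, is_commutator D (pi a) S)].

Definition even_spectral_triple
    (pi : A -> H -> H) (D : set (H * H)) (gamma : H -> H) : Prop :=
  spectral_triple pi D /\
  [/\ bounded_op gamma,
      (forall x y, inner (gamma x) y = inner x (gamma y)),
      (forall x, gamma (gamma x) = x),
      (forall x y, D (x, y) -> D (gamma x, - gamma y)) &
      (forall a x, gamma (pi a x) = pi a (gamma x))].

Definition regular_triple (pi : A -> H -> H) (D : set (H * H)) : Prop :=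
  exists2 P, is_abs_op D P &
    forall a, OP0 P (pi a) /\ exists2 S, is_commutator D (pi a) S & OP0 P S.

Definition regular_even_spectral_triple
    (pi : A -> H -> H) (D : set (H * H)) (gamma : H -> H) : Prop :=
  even_spectral_triple pi D gamma /\ regular_triple pi D.

End Operators.

(* The *-algebra of the Podles sphere: *-polynomials in the symbols A and B
   modulo the least *-algebra congruence containing the defining relations. *)

Inductive podles_term (R : realType) : Type :=
| pgenA
| pgenB
| pscalar of R[i]
| padd of podles_term R & podles_term R
| pmul of podles_term R & podles_term R
| pstar of podles_term R.
Arguments pgenA {R}.
Arguments pgenB {R}.

HB.instance Definition _ (R : realType) := gen_eqMixin (podles_term R).
HB.instance Definition _ (R : realType) := gen_choiceMixin (podles_term R).

Inductive podles_cong (R : realType) (q s : R) :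
  podles_term R -> podles_term R -> Prop :=
(* congruence *)
| pc_refl x : podles_cong q s x x
| pc_sym x y : podles_cong q s x y -> podles_cong q s y x
| pc_trans y x z : podles_cong q s x y -> podles_cong q s y z -> podles_cong q s x z
| pc_add x x' y y' : podles_cong q s x x' -> podles_cong q s y y' ->
    podles_cong q s (padd x y) (padd x' y')
| pc_mul x x' y y' : podles_cong q s x x' -> podles_cong q s y y' ->
    podles_cong q s (pmul x y) (pmul x' y')
| pc_star x x' : podles_cong q s x x' -> podles_cong q s (pstar x) (pstar x')
(* unital algebra *)
| pc_addA x y z : podles_cong q s (padd x (padd y z)) (padd (padd x y) z)
| pc_addC x y : podles_cong q s (padd x y) (padd y x)
| pc_add0 x : podles_cong q s (padd (pscalar 0) x) x
| pc_addN x : podles_cong q s (padd (pmul (pscalar (- 1)) x) x) (pscalar 0)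
| pc_mulA x y z : podles_cong q s (pmul x (pmul y z)) (pmul (pmul x y) z)
| pc_mul1 x : podles_cong q s (pmul (pscalar 1) x) x
| pc_mulDl x y z :
    podles_cong q s (pmul (padd x y) z) (padd (pmul x z) (pmul y z))
| pc_mulDr x y z :
    podles_cong q s (pmul x (padd y z)) (padd (pmul x y) (pmul x z))
| pc_scalarD a b : podles_cong q s (pscalar (a + b)) (padd (pscalar a) (pscalar b))
| pc_scalarM a b : podles_cong q s (pscalar (a * b)) (pmul (pscalar a) (pscalar b))
| pc_scalarC a x : podles_cong q s (pmul (pscalar a) x) (pmul x (pscalar a))
(* involution *)
| pc_starK x : podles_cong q s (pstar (pstar x)) x
| pc_starD x y : podles_cong q s (pstar (padd x y)) (padd (pstar x) (pstar y))
| pc_starM x y : podles_cong q s (pstar (pmul x y)) (pmul (pstar y) (pstar x))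
| pc_star_scalar a : podles_cong q s (pstar (pscalar a)) (pscalar a^*)
(* A = A^*, A B = q^2 B A, B B^* + (A + s^2) (A - 1) = 0 and
   B^* B + (q^2 A + s^2) (q^2 A - 1) = 0 *)
| pc_A_star : podles_cong q s pgenA (pstar pgenA)
| pc_AB : podles_cong q s (pmul pgenA pgenB)
    (pmul (pscalar (q ^+ 2)%:C%C) (pmul pgenB pgenA))
| pc_BBs : podles_cong q s
    (padd (pmul pgenB (pstar pgenB))
          (pmul (padd pgenA (pscalar (s ^+ 2)%:C%C)) (padd pgenA (pscalar (- 1)))))
    (pscalar 0)
| pc_BsB : podles_cong q s
    (padd (pmul (pstar pgenB) pgenB)
          (pmul (padd (pmul (pscalar (q ^+ 2)%:C%C) pgenA) (pscalar (s ^+ 2)%:C%C))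
                (padd (pmul (pscalar (q ^+ 2)%:C%C) pgenA) (pscalar (- 1)))))
    (pscalar 0).

Section PodlesAlgebra.
Context (R : realType) (q s : R).
Local Notation term := (podles_term R).
Local Notation cong := (podles_cong q s).

Definition podles_rel : rel term := fun x y => `[< cong x y >].

Lemma podles_rel_refl : reflexive podles_rel.
Proof. by move=> x; apply/asboolP; exact: pc_refl. Qed.

Lemma podles_rel_sym : symmetric podles_rel.
Proof. by move=> x y; apply/asboolP/asboolP; exact: pc_sym. Qed.

Lemma podles_rel_trans : transitive podles_rel.
Proof.
by move=> y x z /asboolP xy /asboolP yz; apply/asboolP; exact: pc_trans xy yz.
Qed.

Canonical podles_equiv :=
  EquivRel podles_rel podles_rel_refl podles_rel_sym podles_rel_trans.

Definition podles := {eq_quot podles_equiv}.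
HB.instance Definition _ := Choice.on podles.
HB.instance Definition _ := Quotient.on podles.

Local Notation cls := (\pi_podles).

Lemma podles_eqP x y : cls x = cls y <-> cong x y.
Proof.
by split=> [/eqmodP/asboolP|xy]; last by apply/eqmodP/asboolP.
Qed.

Lemma podles_reprP x : cong (repr (cls x)) x.
Proof. by apply/podles_eqP; rewrite reprK. Qed.

Definition podles_scalar (c : R[i]) : podles := cls (pscalar c).
Definition podles_add (x y : podles) : podles := cls (padd (repr x) (repr y)).
Definition podles_mul (x y : podles) : podles := cls (pmul (repr x) (repr y)).
Definition podles_star (x : podles) : podles := cls (pstar (repr x)).
Definition podles_opp (x : podles) : podles := podles_mul (podles_scalar (- 1)) x.
Definition podles_scale (c : R[i]) (x : podles) : podles :=
  podles_mul (podles_scalar c) x.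

Lemma podles_addE x y : podles_add (cls x) (cls y) = cls (padd x y).
Proof. by apply/podles_eqP/pc_add; exact: podles_reprP. Qed.

Lemma podles_mulE x y : podles_mul (cls x) (cls y) = cls (pmul x y).
Proof. by apply/podles_eqP/pc_mul; exact: podles_reprP. Qed.

Lemma podles_starE x : podles_star (cls x) = cls (pstar x).
Proof. by apply/podles_eqP/pc_star; exact: podles_reprP. Qed.

Lemma podles_ind (P : podles -> Prop) : (forall t, P (cls t)) -> forall x, P x.
Proof. by move=> Pc x; rewrite -(reprK x). Qed.

Lemma podles_addA : associative podles_add.
Proof.
elim/podles_ind=> x; elim/podles_ind=> y; elim/podles_ind=> z.
by rewrite !podles_addE; apply/podles_eqP/pc_addA.
Qed.

Lemma podles_addC : commutative podles_add.
Proof.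
elim/podles_ind=> x; elim/podles_ind=> y.
by rewrite !podles_addE; apply/podles_eqP/pc_addC.
Qed.

Lemma podles_add0 : left_id (podles_scalar 0) podles_add.
Proof.
by elim/podles_ind=> x; rewrite podles_addE; apply/podles_eqP/pc_add0.
Qed.

Lemma podles_mulA : associative podles_mul.
Proof.
elim/podles_ind=> x; elim/podles_ind=> y; elim/podles_ind=> z.
by rewrite !podles_mulE; apply/podles_eqP/pc_mulA.
Qed.

Lemma podles_mul1 : left_id (podles_scalar 1) podles_mul.
Proof.
by elim/podles_ind=> x; rewrite podles_mulE; apply/podles_eqP/pc_mul1.
Qed.

Lemma podles_scalarC c x :
  podles_mul (podles_scalar c) x = podles_mul x (podles_scalar c).
Proof.
by elim/podles_ind: x => x; rewrite !podles_mulE; apply/podles_eqP/pc_scalarC.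
Qed.

Lemma podles_mulr1 : right_id (podles_scalar 1) podles_mul.
Proof. by move=> x; rewrite -podles_scalarC podles_mul1. Qed.

Lemma podles_mulDl : left_distributive podles_mul podles_add.
Proof.
elim/podles_ind=> x; elim/podles_ind=> y; elim/podles_ind=> z.
by rewrite !(podles_addE, podles_mulE); apply/podles_eqP/pc_mulDl.
Qed.

Lemma podles_mulDr : right_distributive podles_mul podles_add.
Proof.
elim/podles_ind=> x; elim/podles_ind=> y; elim/podles_ind=> z.
by rewrite !(podles_addE, podles_mulE); apply/podles_eqP/pc_mulDr.
Qed.

Lemma podles_scalarD a b :
  podles_scalar (a + b) = podles_add (podles_scalar a) (podles_scalar b).
Proof. by rewrite podles_addE; apply/podles_eqP/pc_scalarD. Qed.

Lemma podles_scalarM a b :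
  podles_scalar (a * b) = podles_mul (podles_scalar a) (podles_scalar b).
Proof. by rewrite podles_mulE; apply/podles_eqP/pc_scalarM. Qed.

Lemma podles_addN : left_inverse (podles_scalar 0) podles_opp podles_add.
Proof.
elim/podles_ind=> x; rewrite /podles_opp podles_mulE podles_addE.
exact/podles_eqP/pc_addN.
Qed.

Lemma podles_starK : involutive podles_star.
Proof.
by elim/podles_ind=> x; rewrite !podles_starE; apply/podles_eqP/pc_starK.
Qed.

Lemma podles_starD x y :
  podles_star (podles_add x y) = podles_add (podles_star x) (podles_star y).
Proof.
elim/podles_ind: x => x; elim/podles_ind: y => y.
by rewrite !(podles_starE, podles_addE); apply/podles_eqP/pc_starD.
Qed.

Lemma podles_starM x y :
  podles_star (podles_mul x y) = podles_mul (podles_star y) (podles_star x).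
Proof.
elim/podles_ind: x => x; elim/podles_ind: y => y.
by rewrite !(podles_starE, podles_mulE); apply/podles_eqP/pc_starM.
Qed.

Lemma podles_starZ c x :
  podles_star (podles_scale c x) = podles_scale c^* (podles_star x).
Proof.
rewrite /podles_scale podles_starM (podles_scalarC c^*); congr podles_mul.
by rewrite podles_starE; apply/podles_eqP/pc_star_scalar.
Qed.

(* The character with A |-> 0 and B |-> s shows that the algebra is not zero. *)
Fixpoint podles_char (t : term) : R[i] :=
  match t with
  | pgenA => 0
  | pgenB => s%:C%C
  | pscalar c => c
  | padd x y => podles_char x + podles_char y
  | pmul x y => podles_char x * podles_char y
  | pstar x => (podles_char x)^*
  end.

Lemma podles_char_cong x y : cong x y -> podles_char x = podles_char y.
Proof.
have sC : (s%:C%C : R[i])^* = s%:C%C by exact: conjc_real.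
elim=> {x y} //=.
- by move=> y x z _ -> _ ->.
- by move=> x x' y y' _ -> _ ->.
- by move=> x x' y y' _ -> _ ->.
- by move=> x x' _ ->.
- by move=> *; rewrite addrA.
- by move=> *; rewrite addrC.
- by move=> *; rewrite add0r.
- by move=> *; rewrite mulN1r addNr.
- by move=> *; rewrite mulrA.
- by move=> *; rewrite mul1r.
- by move=> *; rewrite mulrDl.
- by move=> *; rewrite mulrDr.
- by move=> *; rewrite mulrC.
- by move=> *; rewrite conjCK.
- by move=> *; rewrite rmorphD.
- by move=> *; rewrite rmorphM mulrC.
- by rewrite conjC0.
- by rewrite mul0r !mulr0.
- by rewrite sC !add0r mulrN1 rmorphXn expr2 subrr.
- by rewrite sC mulr0 !add0r mulrN1 rmorphXn expr2 subrr.
Qed.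

HB.instance Definition _ := GRing.isZmodule.Build podles
  podles_addA podles_addC podles_add0 podles_addN.

Lemma podles_one_neq0 : podles_scalar 1 != 0 :> podles.
Proof.
apply/eqP => /podles_eqP/podles_char_cong /= /eqP.
by rewrite oner_eq0.
Qed.

HB.instance Definition _ := GRing.Zmodule_isNzRing.Build podles
  podles_mulA podles_mul1 podles_mulr1 podles_mulDl podles_mulDr podles_one_neq0.

Lemma podles_scaleA a b x :
  podles_scale a (podles_scale b x) = podles_scale (a * b) x.
Proof. by rewrite /podles_scale podles_scalarM podles_mulA. Qed.

Lemma podles_scaleDr : right_distributive podles_scale +%R.
Proof. by move=> c x y; exact: podles_mulDr. Qed.

Lemma podles_scaleDl x : {morph podles_scale^~ x : a b / a + b}.
Proof. by move=> a b; rewrite /podles_scale podles_scalarD podles_mulDl. Qed.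

HB.instance Definition _ := GRing.Zmodule_isLmodule.Build R[i] podles
  podles_scaleA podles_mul1 podles_scaleDr podles_scaleDl.

Lemma podles_scaleAl (c : R[i]) (x y : podles) : c *: (x * y) = c *: x * y.
Proof. exact: podles_mulA. Qed.

HB.instance Definition _ :=
  GRing.Lmodule_isLalgebra.Build R[i] podles podles_scaleAl.

Lemma podles_scaleAr (c : R[i]) (x y : podles) : c *: (x * y) = x * (c *: y).
Proof.
rewrite /GRing.scale /= /podles_scale -[x * y]/(podles_mul x y).
rewrite -[RHS]/(podles_mul x (podles_mul (podles_scalar c) y)).
by rewrite !podles_mulA podles_scalarC.
Qed.

HB.instance Definition _ :=
  GRing.Lalgebra_isAlgebra.Build R[i] podles podles_scaleAr.

HB.instance Definition _ := isStarAlgebra.Build R[i] podles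
  podles_starK podles_starD podles_starM podles_starZ.

Definition podles_A : podles := cls pgenA.
Definition podles_B : podles := cls pgenB.

End PodlesAlgebra.

(* Half-integers are represented as real numbers. *)

Section PodlesRepresentation.
Context (R : realType) (q s : R).

Definition half_integer (N : R) : Prop := exists z : int, 2 * N = z%:~R.

Definition qnum (x : R) : R := (q `^ x - q `^ (- x)) / (q - q^-1).

Definition podles_alpha (M l : R) : R :=
  (qnum (2 * l))^-1
  * Num.sqrt (qnum 2 * qnum (l + M) * qnum (l - M)
              / (qnum (2 * l - 1) * qnum (2 * l + 1)))
  * Num.sqrt ((q `^ (l + M) + q `^ (- (l + M)) * s ^+ 2)
              * (q `^ (l - M) * s ^+ 2 + q `^ (- (l - M)))).

Definition podles_beta (M l : R) : R :=
  ((qnum (2 * l) - q `^ (l + M + 1) * qnum 2 * qnum (l - M)) * (1 - s ^+ 2)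
   + q * qnum 2 * qnum (2 * M) * s ^+ 2)
  / (q ^+ 2 * qnum (2 * l) * qnum (2 * l + 2)).

(* The triples (M, l, m) labelling the basis vectors |l, m; M> of
   H_{-N} (+) H_N. *)
Definition ket_index (N : R) : set (R * R * R) :=
  [set p | let: (M, l, m) := p in
     [/\ M = N \/ M = - N,
         (exists k : nat, l = `|N| + k%:R),
         (exists j : nat, m = - l + j%:R) & m <= l]].

Definition podles_x1 : podles q s := (Num.sqrt (q * qnum 2))%:C%C *: podles_B q s.
Definition podles_x0 : podles q s :=
  (1 - s ^+ 2)%:C%C *: 1 - (q * qnum 2)%:C%C *: podles_A q s.

Context (H : hilbertType R[i]).

(* In the right-hand sides, [ket \_ ket_index N] replaces the vectors that are
   outside the index set by 0. *)
Definition is_podles_representation (N : R) (ket : R * R * R -> H)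
    (pi : podles q s -> H -> H) : Prop :=
  star_representation pi /\
  forall M l m, ket_index N (M, l, m) ->
    let e := fun l' m' => (ket \_ (ket_index N)) (M, l', m') in
    pi podles_x1 (ket (M, l, m)) =
        (q `^ (- l + m) * Num.sqrt (qnum (l + m + 1) * qnum (l + m + 2))
         * podles_alpha M (l + 1))%:C%C *: e (l + 1) (m + 1)
      - (q `^ (m + 2) * Num.sqrt (qnum 2 * qnum (l - m) * qnum (l + m + 1))
         * podles_beta M l)%:C%C *: e l (m + 1)
      - (q `^ (l + m + 1) * Num.sqrt (qnum (l - m) * qnum (l - m - 1))
         * podles_alpha M l)%:C%C *: e (l - 1) (m + 1)
    /\
    pi podles_x0 (ket (M, l, m)) =
        (q `^ m * Num.sqrt (qnum 2 * qnum (l - m + 1) * qnum (l + m + 1))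
         * podles_alpha M (l + 1))%:C%C *: e (l + 1) m
      + ((qnum (2 * l) - q `^ (l + m + 1) * qnum 2 * qnum (l - m))
         * podles_beta M l)%:C%C *: e l m
      + (q `^ m * Num.sqrt (qnum 2 * qnum (l - m) * qnum (l + m))
         * podles_alpha M l)%:C%C *: e (l - 1) m.

Definition is_grading (N : R) (ket : R * R * R -> H) (gamma : H -> H) : Prop :=
  bounded_op gamma /\
  forall l m, ket_index N (N, l, m) ->
    gamma (ket (- N, l, m)) = ket (- N, l, m) /\
    gamma (ket (N, l, m)) = - ket (N, l, m).

Definition is_dirac (N : R) (ket : R * R * R -> H) (lambda : R -> R)
    (D : set (H * H)) : Prop :=
  self_adjoint D /\
  forall M l m, ket_index N (M, l, m) ->
    D (ket (M, l, m), (lambda l)%:C%C *: ket (- M, l, m)).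

End PodlesRepresentation.

(* Main.v *)
(* In the orthonormal basis of kets, D_lambda and |D_lambda| are given by the
   weights lambda_l, and the generators x_0, x_1 and their adjoints are sums of
   three weighted shifts, each changing l by at most 1. Commuting such a shift
   with |D| multiplies its weight by lambda_l - lambda_(l + a), so bounded gaps
   keep every iterated commutator bounded. For [D, x] one also needs that
   lambda_l (w_N - w_(-N)) is bounded, where w_M denotes a weight of x on H_M:
   the two differ by O(q^l), because alpha_N - alpha_(-N) and
   beta_N - beta_(-N) are O(q^(3l)) while the factors in front of them are
   O(q^(-2l)), and lambda_l grows at most linearly. The operators of the
   algebra are bounded because the sphere relations, paired with a vector, give
   |A x| <= |x|, |B x| <= |x| and |B^* x| <= |x|. *)
Require Import Defs.
From mathcomp Require Import all_boot all_order all_algebra.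
From mathcomp Require Import complex.
From mathcomp Require Import ring lra zify.
From mathcomp Require Import all_classical all_reals.
From mathcomp Require Import topology normedtype sequences exp.

Set Implicit Arguments.
Unset Strict Implicit.
Unset Printing Implicit Defensive.

Import Order.TTheory GRing.Theory Num.Theory.
Import numFieldNormedType.Exports.

Local Open Scope classical_set_scope.
Local Open Scope ring_scope.

(** * Operators on Hilbert spaces *)

(** All arguments run on the coordinates [inner (e t) x]. [D] and [|D|] are given by coordinate
    equations on their maximal domains, so a bounded operator known by its rows is seen to preserve
    these domains without any approximation. The kets get integer labels and are 0 outside the index
    set, which turns the shifts of l and m into bijections of the labels. The representation,
    however, gives the images of the kets, that is, columns. The rows of an operator are the
    conjugated columns of its adjoint, hence each generator is treated together with its adjoint.
    The size of the weights is not estimated: a weight is a matrix entry of an operator already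
    known to be bounded. Only the differences between M = N and M = -N need estimates. In alpha the
    factor 1/[2l] gives q^(2l) and the first root gives q^l, while the second radicands differ by a
    quantity that does not depend on l. In beta the numerators differ by a quantity that does not
    depend on l. *)

Section InnerProduct.
Context (C : numClosedFieldType) (H : hilbertType C).
Implicit Types (x y z : H) (c : C).

Lemma innerDl x y z : inner (x + y) z = inner x z + inner y z.
Proof. by rewrite inner_conj innerDr rmorphD /= -!inner_conj. Qed.

Lemma innerZl c x z : inner (c *: x) z = c^* * inner x z.
Proof. by rewrite inner_conj innerZr rmorphM /= -inner_conj. Qed.

Lemma inner0r x : inner x 0 = 0.
Proof. by rewrite -(scale0r (0 : H)) innerZr mul0r. Qed.

Lemma inner0l x : inner 0 x = 0.
Proof. by rewrite inner_conj inner0r rmorph0. Qed.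

Lemma innerNr x y : inner x (- y) = - inner x y.
Proof. by rewrite -scaleN1r innerZr mulN1r. Qed.

Lemma innerNl x y : inner (- x) y = - inner x y.
Proof. by rewrite inner_conj innerNr rmorphN /= -inner_conj. Qed.

Lemma innerBr x y z : inner x (y - z) = inner x y - inner x z.
Proof. by rewrite innerDr innerNr. Qed.

Lemma innerBl x y z : inner (x - y) z = inner x z - inner y z.
Proof. by rewrite innerDl innerNl. Qed.

Lemma inner_sumr (I : Type) (r : seq I) (P : pred I) (F : I -> H) x :
  inner x (\sum_(i <- r | P i) F i) = \sum_(i <- r | P i) inner x (F i).
Proof. exact: (big_morph _ (innerDr x) (inner0r x)). Qed.

Lemma inner_suml (I : Type) (r : seq I) (P : pred I) (F : I -> H) x :
  inner (\sum_(i <- r | P i) F i) x = \sum_(i <- r | P i) inner (F i) x.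
Proof. exact: (big_morph _ (fun y z => innerDl y z x) (inner0l x)). Qed.

Lemma inner_linear x : linear (inner x).
Proof. by move=> c y z; rewrite innerDr innerZr. Qed.

Lemma cauchy_schwarz x y : `|inner x y| <= `|x| * `|y|.
Proof.
have [->|x0] := eqVneq x 0; first by rewrite inner0l !normr0 mul0r.
have nx : 0 < `|x| ^+ 2 by rewrite exprn_gt0 ?normr_gt0.
pose c := inner x y / `|x| ^+ 2.
have xz : inner x (y - c *: x) = 0.
  by rewrite innerBr innerZr inner_norm /c divfK ?gt_eqF ?subrr.
have : 0 <= inner (y - c *: x) (y - c *: x) by rewrite inner_norm exprn_ge0.
rewrite {1}innerBl innerZl xz mulr0 subr0 innerBr innerZr inner_norm.
rewrite (inner_conj x y) /c mulrAC -normCK subr_ge0 ler_pdivrMr //.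
rewrite -exprMn ler_pXn2r ?nnegrE ?mulr_ge0 //.
by rewrite mulrC.
Qed.

End InnerProduct.

Section BoundedOperators.
Context (C : numClosedFieldType) (H : hilbertType C).
Implicit Types (X Y : H -> H).

(** The constant in [bounded_op] is an arbitrary element of [C]. A nonzero vector forces it to be
    real and nonnegative; adding 1 makes it positive. *)
Lemma bounded_opP X : bounded_op X ->
  exists2 K : C, 0 < K & forall x, `|X x| <= K * `|x|.
Proof.
move=> [_ [K XK]]; exists (`|K| + 1); first by rewrite ltr_wpDl.
move=> x; have [->|x0] := eqVneq x 0.
  by move: (XK 0); rewrite !normr0 !mulr0.
apply: (le_trans (XK x)); rewrite ler_wpM2r //.
have Kr : 0 <= K.
  by move: (le_trans (normr_ge0 _) (XK x)); rewrite pmulr_lge0 ?normr_gt0.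
by rewrite ger0_norm // lerDl.
Qed.

Lemma bounded_op_id : bounded_op (@id H).
Proof. by split=> //; exists 1 => x; rewrite mul1r. Qed.

Lemma bounded_opD X Y : bounded_op X -> bounded_op Y -> bounded_op (X \+ Y).
Proof.
move=> [lX [K XK]] [lY [L YL]]; split.
  by move=> c x y /=; rewrite lX lY scalerDr addrACA.
exists (K + L) => x; rewrite mulrDl.
by apply: (le_trans (ler_normD _ _)); rewrite lerD.
Qed.

Lemma bounded_opZ (c : C) X : bounded_op X -> bounded_op (fun x => c *: X x).
Proof.
move=> [lX [K XK]]; split.
  by move=> d x y /=; rewrite lX scalerDr !scalerA mulrC.
by exists (`|c| * K) => x; rewrite normrZ -mulrA ler_wpM2l.
Qed.

Lemma bounded_opM X Y : bounded_op X -> bounded_op Y -> bounded_op (X \o Y).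
Proof.
move=> bX [lY [L YL]]; have [K K0 XK] := bounded_opP bX; split.
  by move=> d x y /=; rewrite lY (proj1 bX).
exists (K * L) => x /=; rewrite -mulrA.
by apply: (le_trans (XK _)); rewrite ler_pM2l.
Qed.

End BoundedOperators.

(** * Orthonormal bases *)

Section OrthonormalSystem.
Context (C : numClosedFieldType) (H : hilbertType C) (T : countType).
Context (dom : pred T) (e : T -> H).
(** This forces [e t = 0] off [dom], so that a shift of labels can be total and a term that leaves
    the index set disappears by itself. *)
Hypothesis orth : forall s t, inner (e s) (e t) = ((s == t) && dom t)%:R.
Implicit Types (x y : H) (s t : T) (r : seq T) (a : T -> C).

Lemma ons_ndom t : ~~ dom t -> e t = 0.
Proof.
move=> nd; apply/eqP; rewrite -normr_eq0 -sqrf_eq0 -inner_norm.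
by rewrite orth (negPf nd) andbF.
Qed.

Lemma coord_ndom t x : ~~ dom t -> inner (e t) x = 0.
Proof. by move=> /ons_ndom->; rewrite inner0l. Qed.

Lemma coord_sum r a t : uniq r ->
  inner (e t) (\sum_(u <- r) a u *: e u) = if (t \in r) && dom t then a t else 0.
Proof.
move=> ur; rewrite inner_sumr.
under eq_bigr do rewrite innerZr orth.
case: ifPn => [/andP[tr dt]|].
  rewrite (bigD1_seq t) //= eqxx dt mulr1 big1 ?addr0 // => i it.
  by rewrite eq_sym (negPf it) mulr0.
rewrite negb_and => tr; rewrite big_seq big1 // => i ir.
have [ti|] := eqVneq t i; last by rewrite mulr0.
by move: tr; rewrite ti ir /= => /negPf->; rewrite mulr0.
Qed.

Lemma norm_sum r a : uniq r ->
  `|\sum_(u <- r) a u *: e u| ^+ 2 = \sum_(u <- r | dom u) `|a u| ^+ 2.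
Proof.
move=> ur; rewrite -inner_norm {1}inner_suml [RHS]big_mkcond /=.
rewrite [LHS]big_seq [RHS]big_seq; apply: eq_bigr => u ru.
rewrite innerZl coord_sum // ru /=; case: ifP => _; last by rewrite mulr0.
by rewrite mulrC -normCK.
Qed.

Lemma bessel r x : uniq r -> \sum_(t <- r) `|inner (e t) x| ^+ 2 <= `|x| ^+ 2.
Proof.
move=> ur; set p := \sum_(t <- r) inner (e t) x *: e t.
have px : inner p x = \sum_(t <- r) `|inner (e t) x| ^+ 2.
  by rewrite inner_suml; apply: eq_bigr => t _; rewrite innerZl mulrC -normCK.
have pp : inner p p = \sum_(t <- r) `|inner (e t) x| ^+ 2.
  rewrite inner_norm norm_sum // big_mkcond /=; apply: eq_bigr => t _.
  by case: ifPn => // /coord_ndom ->; rewrite normr0 expr0n.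
have xp : inner x p = \sum_(t <- r) `|inner (e t) x| ^+ 2.
  rewrite inner_conj px rmorph_sum /=; apply: eq_bigr => t _.
  by rewrite conj_Creal // rpredX // normr_real.
have : 0 <= inner (x - p) (x - p) by rewrite inner_norm exprn_ge0.
by rewrite innerBr !innerBl px pp xp inner_norm subrr subr0 subr_ge0.
Qed.

Hypothesis dense_e : dense (linear_span (e @` [set t | dom t])).

(** If [f x] were not 0, a point [y] of the span closer to [x] than [|f x| / K] would give
    [|f x| = |f (x - y)| < |f x|]. *)
Lemma functional_eq0 (f : H -> C) (K : C) :
  (forall c x y, f (c *: x + y) = c * f x + f y) ->
  (forall x, `|f x| <= K * `|x|) ->
  (forall t, dom t -> f (e t) = 0) -> forall x, f x = 0.
Proof.
move=> lf fK fe x.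
have f0 : f 0 = 0.
  have := lf 1 0 0; rewrite scale1r addr0 mul1r => /eqP.
  by rewrite addrC -subr_eq subrr eq_sym => /eqP.
apply/eqP; rewrite -normr_eq0; apply/negP => /negP fx0.
have fx : 0 < `|f x| by rewrite lt_def fx0 normr_ge0.
have x0 : x != 0.
  by apply/negP => /eqP xe; move: fx; rewrite xe f0 normr0 ltxx.
have K0 : 0 < K.
  by move: (lt_le_trans fx (fK x)); rewrite pmulr_lgt0 ?normr_gt0.
have eps : 0 < `|f x| / K by rewrite divr_gt0.
have [y [xy [n [c [v [ev ye]]]]]] :
    ball x (`|f x| / K) `&` linear_span (e @` [set t | dom t]) !=set0.
  by apply: dense_e; [exists x; exact: ballxx|exact: ball_open].
have fy : f y = 0.
  rewrite ye (big_morph f (id1 := 0) (op1 := +%R)) //; last first.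
    by move=> u w; rewrite -[u]scale1r lf mul1r scale1r.
  rewrite big1 // => k _; have [t dt <-] := ev k.
  by rewrite -[_ *: _]addr0 lf f0 addr0 fe // mulr0.
have fxy : f x = f (x - y) by rewrite addrC -scaleN1r lf fy mulr0 add0r.
have : `|f x| < `|f x|.
  rewrite {1}fxy; apply: (le_lt_trans (fK _)).
  by move: xy; rewrite -ball_normE /ball_ /= ltr_pdivlMr // mulrC.
by rewrite ltxx.
Qed.

Lemma coord_inj x y :
  (forall t, dom t -> inner (e t) x = inner (e t) y) -> x = y.
Proof.
move=> xy; apply/subr0_eq.
have fz : forall z, inner (x - y) z = 0.
  apply: (functional_eq0 (K := `|x - y|)); first exact: inner_linear.
    by move=> z; exact: cauchy_schwarz.
  by move=> t dt; rewrite inner_conj innerBr xy // subrr rmorph0.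
by apply/eqP; rewrite -normr_eq0 -sqrf_eq0 -inner_norm fz.
Qed.

Lemma bounded_op_eq (X Y : H -> H) : bounded_op X -> bounded_op Y ->
  (forall t, dom t -> X (e t) = Y (e t)) -> X =1 Y.
Proof.
move=> bX bY XY x; apply: coord_inj => t dt; apply: subr0_eq.
have [K K0 XK] := bounded_opP bX; have [L L0 YL] := bounded_opP bY.
apply: (@functional_eq0 (fun x => inner (e t) (X x) - inner (e t) (Y x)) (`|e t| * (K + L))).
- move=> c u v; rewrite (proj1 bX) (proj1 bY) !innerDr !innerZr.
  by rewrite mulrBr opprD addrACA.
- move=> u; apply: (le_trans (ler_normB _ _)); rewrite -mulrA mulrDl mulrDr.
  by apply: lerD; apply: (le_trans (cauchy_schwarz _ _)); rewrite ler_wpM2l.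
- by move=> u du; rewrite XY // subrr.
Qed.

Lemma bounded_op_adj (X Y : H -> H) : bounded_op X -> bounded_op Y ->
  (forall s t, dom s -> dom t -> inner (X (e s)) (e t) = inner (e s) (Y (e t))) ->
  forall x y, inner (X x) y = inner x (Y y).
Proof.
move=> bX bY XY x y.
have [K K0 XK] := bounded_opP bX; have [L L0 YL] := bounded_opP bY.
have XY1 s : dom s -> forall z, inner (X (e s)) z = inner (e s) (Y z).
  move=> ds z; apply: subr0_eq.
  apply: (@functional_eq0 (fun z => inner (X (e s)) z - inner (e s) (Y z))
    (`|X (e s)| + `|e s| * L)).
  - move=> c u v; rewrite (proj1 bY) !innerDr !innerZr.
    by rewrite mulrBr opprD addrACA.
  - move=> u; apply: (le_trans (ler_normB _ _)); rewrite mulrDl -mulrA.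
    by apply: lerD; apply: (le_trans (cauchy_schwarz _ _)); rewrite // ler_wpM2l.
  - by move=> u du; rewrite XY // subrr.
(* Both sides are antilinear in [x]; conjugation makes them linear, as [functional_eq0] requires. *)
rewrite inner_conj [RHS]inner_conj; congr (_^*); apply: subr0_eq.
apply: (@functional_eq0 (fun x => inner y (X x) - inner (Y y) x)
    (`|y| * K + `|Y y|)).
- move=> c u v; rewrite (proj1 bX) !innerDr !innerZr.
  by rewrite mulrBr opprD addrACA.
- move=> u; apply: (le_trans (ler_normB _ _)); rewrite mulrDl -mulrA.
  by apply: lerD; apply: (le_trans (cauchy_schwarz _ _)); rewrite // ler_wpM2l.
- by move=> u du; rewrite inner_conj XY1 // -inner_conj subrr.
Qed.

End OrthonormalSystem.

(** The assumption under which series with bounded square sums have Cauchy partial sums; it can fail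
    over a non-Archimedean [C]. *)
Definition monotone_complete (C : numDomainType) := forall (u : nat -> C) (B : C),
  {homo u : m n / (m <= n)%N >-> m <= n} -> (forall n, 0 <= u n <= B) ->
  forall eps, 0 < eps -> exists m, forall n, (m <= n)%N -> u n - u m < eps.

Lemma complex_monotone_complete (R : realType) : monotone_complete R[i].
Proof.
move=> u B u_nd uB eps eps0.
have epsE : eps = (complex.Re eps)%:C%C by rewrite RRe_real // gtr0_real.
have Re0 : 0 < complex.Re eps by rewrite -ltcR -epsE.
pose v n := complex.Re (u n).
have uE n : u n = (v n)%:C%C.
  by rewrite RRe_real // ger0_real //; have /andP[] := uB n.
have v_nd m n : (m <= n)%N -> v m <= v n by move=> /u_nd; rewrite !uE lecR.
have vsup : has_sup (range v).
  split; first by exists (v 0%N), 0%N.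
  exists (complex.Re B) => _ [n _ <-].
  by have /andP[_] := uB n; rewrite lecE => /andP[].
have [_ [m _ <-] lt_m] := sup_adherent Re0 vsup.
exists m => n mn; rewrite !uE epsE -rmorphB ltcR ltrBlDr.
apply: (@le_lt_trans _ _ (sup (range v))).
  by apply: ub_le_sup; [case: vsup|exists n].
by rewrite -ltrBlDl.
Qed.

Section RieszFischer.
Context (C : numClosedFieldType) (H : hilbertType C) (T : countType).
Context (dom : pred T) (e : T -> H).
Hypothesis C_complete : monotone_complete C.
Hypothesis orth : forall s t, inner (e s) (e t) = ((s == t) && dom t)%:R.
Implicit Types (x y : H) (s t : T) (r : seq T) (a : T -> C).

(** The labels with code below [n]: a finite exhaustion of [T] along which Fourier series are
    summed. *)
Let E n : seq T := pmap pickle_inv (iota 0 n).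

Let E_uniq n : uniq (E n).
Proof. by apply: (pmap_uniq (@pickle_invK T)); exact: iota_uniq. Qed.

Let mem_E t n : (pickle t < n)%N -> t \in E n.
Proof.
move=> tn; rewrite mem_pmap -(@pickleK_inv T t); apply: map_f.
by rewrite mem_iota.
Qed.

Let E_cat m n : (m <= n)%N -> exists r, E n = E m ++ r.
Proof.
move=> mn; rewrite /E -(subnK mn) addnC iotaD pmap_cat.
by exists (pmap pickle_inv (iota (0 + m) (n - m))).
Qed.

(** The partial sums satisfy [|S n - S m|^2 = u n - u m] with [u] increasing and bounded, so they
    are Cauchy. The norm bound passes to the limit from [|S n| <= M]. *)
Lemma riesz_fischer a (M : C) : 0 <= M ->
  (forall r, uniq r -> \sum_(t <- r | dom t) `|a t| ^+ 2 <= M ^+ 2) ->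
  exists2 x, forall t, dom t -> inner (e t) x = a t & `|x| <= M.
Proof.
move=> M0 aM.
pose S n := \sum_(t <- E n) a t *: e t.
pose u n := \sum_(t <- E n | dom t) `|a t| ^+ 2.
have u_nd : {homo u : m n / (m <= n)%N >-> m <= n}.
  move=> m n /E_cat [r Er]; rewrite /u Er big_cat /= lerDl.
  by rewrite sumr_ge0 // => t _; rewrite exprn_ge0.
have uM n : 0 <= u n <= M ^+ 2.
  by rewrite aM // andbT sumr_ge0 // => t _; rewrite exprn_ge0.
have Su m n : (m <= n)%N -> `|S n - S m| ^+ 2 = u n - u m.
  move=> /E_cat [r Er]; rewrite /S /u Er !big_cat /= ![in _ + _ - _]addrAC !subrr !add0r.
  by rewrite (norm_sum orth) //; have := E_uniq n; rewrite Er cat_uniq => /and3P[].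
have Sc : cauchy (S @ \oo).
  apply: cauchy_exP => eps eps0.
  have [m um] := C_complete u_nd uM (exprn_gt0 2 eps0).
  exists (S m); exists m => // n /= mn.
  rewrite -ball_normE /ball_ /= distrC -(@ltr_pXn2r _ 2) ?nnegrE ?(ltW eps0) //.
  by rewrite Su // um.
have [x Sx] : exists x, S @ \oo --> x by apply/cvg_ex; exact: cauchy_cvg Sc.
have Sball eps : 0 < eps -> exists n0, forall n, (n0 <= n)%N -> `|x - S n| < eps.
  move=> eps0; have [n0 _ h] := Sx _ (nbhsx_ballx x _ eps0).
  by exists n0 => n /h; rewrite /= -ball_normE.
exists x.
  move=> t dt; apply/subr0_eq/eqP; rewrite -normr_le0.
  apply/ler_addgt0Pl => eps eps0; rewrite addr0.
  have et : `|e t| = 1.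
    by apply/eqP; rewrite -(@pexpr_eq1 _ _ 2) // -inner_norm orth eqxx dt.
  have [n0 hn] := Sball _ eps0.
  have {hn} := hn (maxn n0 (pickle t).+1) (leq_maxl _ _).
  set n := maxn _ _ => hn.
  have <- : inner (e t) (S n) = a t.
    by rewrite (coord_sum orth) // dt andbT mem_E // leq_maxr.
  rewrite -innerBr; apply: (le_trans (cauchy_schwarz _ _)).
  by rewrite et mul1r ltW.
apply/ler_addgt0Pl => eps eps0.
have [n /(_ n (leqnn n)) hn] := Sball _ eps0.
rewrite -(subrK (S n) x); apply: (le_trans (ler_normD _ _)).
apply: lerD; first exact: ltW.
rewrite -(@ler_pXn2r _ 2) ?nnegrE // (norm_sum orth) //; exact: aM.
Qed.

Hypothesis dense_e : dense (linear_span (e @` [set t | dom t])).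

Lemma norm_le_coord x (M : C) : 0 <= M ->
  (forall r, uniq r -> \sum_(t <- r | dom t) `|inner (e t) x| ^+ 2 <= M ^+ 2) ->
  `|x| <= M.
Proof.
move=> M0 xM; have [y yx yM] := riesz_fischer M0 xM.
by rewrite -(coord_inj dense_e yx).
Qed.

Section WeightedShift.
Context (w : T -> C) (tau : T -> T) (K : C).
Hypotheses (tau_inj : injective tau) (K0 : 0 <= K).
Hypothesis wK : forall t, dom t -> dom (tau t) -> `|w t| <= K.

(** Injectivity of [tau] keeps the shifted labels distinct, so [bessel] applies to them. Where
    [tau t] leaves [dom] the coordinate is 0, so [wK] bounds [w] only between labels of [dom]. *)
Let shift_bessel x r : uniq r ->
  \sum_(t <- r | dom t) `|w t * inner (e (tau t)) x| ^+ 2 <= (K * `|x|) ^+ 2.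
Proof.
move=> ur; rewrite exprMn.
apply: (@le_trans _ _ (\sum_(t <- r | dom t) K ^+ 2 * `|inner (e (tau t)) x| ^+ 2)).
  apply: ler_sum => t dt; rewrite normrM exprMn.
  have [dt'|/(coord_ndom orth) ->] := boolP (dom (tau t)); last first.
    by rewrite normr0 expr0n /= !mulr0.
  by rewrite ler_wpM2r ?exprn_ge0 // ler_pXn2r ?nnegrE // wK.
rewrite -mulr_sumr ler_wpM2l ?exprn_ge0 //.
have ur' : uniq [seq tau t | t <- r] by rewrite map_inj_uniq.
apply: le_trans (bessel orth x ur').
rewrite big_map big_mkcond /= ler_sum // => t _; case: ifP => // _.
by rewrite exprn_ge0.
Qed.

Lemma norm_le_weighted_shift x y :
  (forall t, dom t -> inner (e t) y = w t * inner (e (tau t)) x) ->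
  `|y| <= K * `|x|.
Proof.
move=> yx; apply: norm_le_coord => [|r ur]; first by rewrite mulr_ge0.
by rewrite (eq_bigr _ (fun t dt => congr1 (fun z => `|z| ^+ 2) (yx t dt))) shift_bessel.
Qed.

(** Each [X x] is built separately from its coordinates; linearity follows afterwards because
    coordinates determine a vector. *)
Lemma weighted_shift_exists : exists2 X : H -> H, bounded_op X &
  forall x t, dom t -> inner (e t) (X x) = w t * inner (e (tau t)) x.
Proof.
have /choice [X XE] x : exists y, forall t, dom t ->
    inner (e t) y = w t * inner (e (tau t)) x.
  have Kx : 0 <= K * `|x| by rewrite mulr_ge0.
  by have [y yx _] := riesz_fischer Kx (@shift_bessel x); exists y.
exists X => //; split; last by exists K => x; apply: norm_le_weighted_shift => t dt; exact: XE.
move=> c x y; apply: (coord_inj dense_e) => t dt.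
by rewrite innerDr innerZr !XE // innerDr innerZr mulrDr mulrCA.
Qed.

End WeightedShift.

End RieszFischer.

(** * Diagonal operators *)

Section LinearOperators.
Context (C : numClosedFieldType) (H : hilbertType C) (X : H -> H).
Hypothesis lX : linear X.

Lemma linear_opD x y : X (x + y) = X x + X y.
Proof. by rewrite -{1}[x]scale1r lX scale1r. Qed.

Lemma linear_op0 : X 0 = 0.
Proof. by apply: (@addrI _ (X 0)); rewrite -linear_opD !addr0. Qed.

Lemma linear_opZ c x : X (c *: x) = c *: X x.
Proof. by rewrite -[c *: x]addr0 lX linear_op0 addr0. Qed.

Lemma linear_op_sum (I : Type) (r : seq I) (c : I -> C) (v : I -> H) :
  X (\sum_(i <- r) c i *: v i) = \sum_(i <- r) c i *: X (v i).
Proof.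
by elim: r => [|i r IH]; rewrite ?big_nil ?big_cons ?linear_op0 // lX IH.
Qed.

End LinearOperators.

Section DiagonalGraphs.
Context (C : numClosedFieldType) (H : hilbertType C) (T : countType).
Context (dom : pred T) (e : T -> H).
Hypothesis C_complete : monotone_complete C.
Hypothesis orth : forall s t, inner (e s) (e t) = ((s == t) && dom t)%:R.
Hypothesis dense_e : dense (linear_span (e @` [set t | dom t])).
Implicit Types (x y : H) (s t : T) (mu : T -> C) (theta : T -> T).

(* The operator e_t |-> mu_t e_(theta t), on its maximal domain, when theta is
   an involution and mu o theta = mu. *)
Definition diag_graph mu theta : set (H * H) :=
  [set p | forall t, dom t -> inner (e t) p.2 = mu t * inner (e (theta t)) p.1].

Section Involution.
Context (mu : T -> C) (theta : T -> T) (c : C).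
Hypothesis thetaK : involutive theta.
Hypothesis dom_theta : forall t, dom (theta t) = dom t.
Hypothesis mu_theta : forall t, mu (theta t) = mu t.
Hypothesis c_gt0 : 0 < c.
Hypothesis c_le : forall t, dom t -> c <= mu t.

Let mu_gt0 t : dom t -> 0 < mu t.
Proof. by move=> /c_le; exact: lt_le_trans. Qed.

Let theta_inj : injective theta. Proof. exact: can_inj thetaK. Qed.

Lemma diag_graph_ket t : dom t -> diag_graph mu theta (e t, mu t *: e (theta t)).
Proof.
move=> dt s ds /=; rewrite innerZr !orth dom_theta dt (inv_eq thetaK).
by have [->|] := eqVneq s (theta t); rewrite ?mu_theta //= !mulr0.
Qed.

(** The lower bound [c] on the weights makes the inverse bounded. The unbounded graph then consists
    of the pairs [(X y, y)], and its properties are proved through [X]. *)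
Lemma diag_inverse_exists : exists2 X, bounded_op X &
  (forall x y, diag_graph mu theta (x, y) <-> X y = x) /\
  forall y t, dom t -> inner (e t) (X y) = (mu t)^-1 * inner (e (theta t)) y.
Proof.
have wK t : dom t -> dom (theta t) -> `|(mu t)^-1| <= c^-1.
  move=> dt _; rewrite gtr0_norm ?invr_gt0 ?mu_gt0 //.
  by rewrite lef_pV2 ?posrE ?mu_gt0 ?c_le.
have ci : 0 <= c^-1 by rewrite invr_ge0 ltW.
have [X bX XE] := weighted_shift_exists C_complete orth dense_e theta_inj ci wK.
exists X => //; split=> // x y; split=> [xy|<- t dt] /=.
  apply: (coord_inj dense_e) => t dt.
  rewrite XE // xy ?dom_theta //= thetaK mu_theta mulKf // gt_eqF //.
  exact: mu_gt0.
by rewrite XE ?dom_theta // thetaK mu_theta mulVKf // gt_eqF // mu_gt0.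
Qed.

Lemma diag_self_adjoint : self_adjoint (diag_graph mu theta).
Proof.
have [X bX [XP XE]] := diag_inverse_exists.
split.
  move=> O O0 oO; have [y [Oy [n [k [v [ev ye]]]]]] := dense_e O0 oO.
  rewrite ye in Oy; move: Oy; set z := \sum_(i < n) _ => Oz; exists z; split => //.
  (* Every ket is the image under [X] of a multiple of a ket, so the whole span lies in the
     domain. *)
  suff : forall i, exists u, X u = v i.
    move=> /choice [u uE]; exists (z, \sum_(i < n) k i *: u i) => //.
    apply/XP; rewrite (linear_op_sum (proj1 bX)).
    by apply: eq_bigr => i _; rewrite uE.
  move=> i; have [t dt <-] := ev i; exists (mu t *: e (theta t)).
  exact/XP/diag_graph_ket.
(* Adjointness tested on kets is exactly the coordinate equation of the graph. Conversely, on pairs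
   [(X y, y)] adjointness is the symmetry of [X]. *)
apply/seteqP; split=> [[x y] xy t dt|[x y] /XP <- u v /XP <-] /=.
  have /= := xy _ _ (diag_graph_ket dt).
  rewrite innerZr inner_conj [inner x _]inner_conj => /(congr1 (fun z => z^*)).
  by rewrite rmorphM /= !conjCK conj_Creal // gtr0_real ?mu_gt0.
apply/esym; apply: (bounded_op_adj dense_e) => // s t ds dt.
rewrite inner_conj !XE // !orth rmorphM /= rmorph_nat fmorphV /= conj_Creal ?gtr0_real ?mu_gt0 //.
rewrite !dt ds !andbT (inv_eq thetaK) eq_sym.
by have [<-|] := eqVneq (theta s) t; rewrite ?mu_theta //= !mulr0.
Qed.

Lemma diag_flip_exists : exists F : H -> H,
  forall x t, dom t -> inner (e t) (F x) = inner (e (theta t)) x.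
Proof.
have wK t : dom t -> dom (theta t) -> `|1 : C| <= 1 by rewrite normr1.
have [F _ FE] := weighted_shift_exists C_complete orth dense_e theta_inj ler01 wK.
by exists F => x t dt; rewrite FE // mul1r.
Qed.

(** Both squares multiply coordinates by [mu^2]; they differ only in the intermediate vector, which
    is [y] for one and its flip [F y] for the other. *)
Lemma diag_comp_abs :
  comp_op (diag_graph mu id) (diag_graph mu id) =
  comp_op (diag_graph mu theta) (diag_graph mu theta).
Proof.
have [F FE] := diag_flip_exists.
apply/seteqP; split=> -[x z] [y /= xy yz]; exists (F y) => t dt /=.
- by rewrite FE // xy ?dom_theta //= mu_theta.
- by rewrite yz //= FE ?dom_theta // thetaK.
- by rewrite FE // xy ?dom_theta //= mu_theta thetaK.
- by rewrite yz //= FE.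
Qed.

(** From [(D + i)^-1 = (D - i) (D^2 + 1)^-1]. The part with [D] moves labels by [theta] and the
    other is diagonal, so each is a single weighted shift. *)
Lemma diag_resolvent_exists : exists K1 K2 : H -> H,
  [/\ bounded_op K1, bounded_op K2, is_resolvent (diag_graph mu theta) (K1 \+ K2),
    forall x t, dom t ->
      inner (e t) (K1 x) = mu t / (mu t ^+ 2 + 1) * inner (e (theta t)) x &
    forall x t, dom t ->
      inner (e t) (K2 x) = - 'i / (mu t ^+ 2 + 1) * inner (e t) x].
Proof.
have c2 : 0 <= c^-1 by rewrite invr_ge0 ltW.
have d0 t : dom t -> 0 < mu t ^+ 2 + 1.
  by move=> dt; rewrite ltr_wpDl // exprn_ge0 // ltW ?mu_gt0.
have w1 t : dom t -> dom (theta t) -> `|mu t / (mu t ^+ 2 + 1)| <= c^-1.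
  move=> dt _; rewrite gtr0_norm ?divr_gt0 ?mu_gt0 ?d0 //.
  apply: (@le_trans _ _ (mu t)^-1); last by rewrite lef_pV2 ?posrE ?mu_gt0 ?c_le.
  rewrite ler_pdivrMr ?d0 // mulrDr expr2 mulKf ?gt_eqF ?mu_gt0 //.
  by rewrite lerDl mulr1 invr_ge0 ltW ?mu_gt0.
have w2 t : dom t -> dom (id t) -> `|- 'i / (mu t ^+ 2 + 1) : C| <= 1.
  move=> dt _; rewrite normrM normrN normCi mul1r normfV gtr0_norm ?d0 //.
  by rewrite invf_le1 ?d0 // lerDr exprn_ge0 // ltW ?mu_gt0.
have [K1 bK1 K1E] := weighted_shift_exists C_complete orth dense_e theta_inj c2 w1.
have [K2 bK2 K2E] := weighted_shift_exists C_complete orth dense_e (@inj_id T) ler01 w2.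
exists K1, K2; split => // x z.
have i2 : 'i ^+ 2 = -1 :> C by exact: sqrCi.
split=> [<- {x}|[y xy <-]] /=.
  exists (z - 'i *: (K1 z + K2 z)); last by rewrite subrK.
  move=> t dt /=; have dt' : dom (theta t) by rewrite dom_theta.
  rewrite innerBr innerZr !innerDr K1E // K2E // K1E // K2E // thetaK mu_theta.
  have := d0 _ dt; move: (mu t) (inner _ _) (inner _ _) => m a b /lt0r_neq0 m0.
  by field: i2.
apply: (coord_inj dense_e) => t dt; have dt' : dom (theta t) by rewrite dom_theta.
rewrite innerDr K1E // K2E // !innerDr !innerZr !xy //= thetaK mu_theta.
have := d0 _ dt; move: (mu t) (inner _ _) (inner _ _) => m a b /lt0r_neq0 m0.
by field: i2.
Qed.

End Involution.

(** With [V] the square root of the bounded inverse [X], the form is [inner (X y) y = |V y|^2],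
    which involves bounded operators only. *)
Lemma diag_positive mu (c : C) : 0 < c -> (forall t, dom t -> c <= mu t) ->
  positive_op (diag_graph mu id).
Proof.
move=> c0 cmu; have mu0 t : dom t -> 0 < mu t by move=> /cmu; exact: lt_le_trans.
have idK : involutive (@id T) by [].
have [X bX [XP XE]] := diag_inverse_exists idK (fun=> erefl) (fun=> erefl) c0 cmu.
have wK t : dom t -> dom (id t) -> `|sqrtC (mu t)^-1| <= sqrtC c^-1.
  move=> dt _; have m0 := mu0 _ dt.
  rewrite ger0_norm ?sqrtC_ge0 ?invr_ge0 ?(ltW m0) //.
  by rewrite ler_sqrtC ?nnegrE ?invr_ge0 ?(ltW m0) ?(ltW c0) // lef_pV2 ?posrE ?cmu.
have cK : 0 <= sqrtC c^-1 by rewrite sqrtC_ge0 invr_ge0 ltW.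
have [V bV VE] := weighted_shift_exists C_complete orth dense_e (@inj_id T) cK wK.
move=> x y /XP <-.
have -> : X y = V (V y).
  apply: (coord_inj dense_e) => t dt.
  by rewrite XE // !VE //= mulrA -expr2 sqrtCK.
have VV : forall x y, inner (V x) y = inner x (V y).
  apply: (bounded_op_adj dense_e) => // s t ds dt.
  rewrite inner_conj !VE // !orth rmorphM /= rmorph_nat.
  rewrite conj_Creal ?ger0_real ?sqrtC_ge0 ?invr_ge0 ?ltW ?mu0 //.
  by rewrite ds dt !andbT eq_sym; have [->|] := eqVneq s t; rewrite ?mulr0.
by rewrite VV inner_norm exprn_ge0.
Qed.

End DiagonalGraphs.

(** * Compact operators *)

(** For an ultrafilter a cluster point is a limit: the complement of a neighbourhood cannot belong
    to the filter as well. *)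
Lemma ultra_image_cvg (S : Type) (X : topologicalType) (U : set_system S)
    (f : S -> X) (A : set X) : UltraFilter U -> compact A -> U (f @^-1` A) ->
  exists2 a, A a & f @ U --> a.
Proof.
move=> UU cA UA; have [a [Aa cl_a]] := cA (f @ U) _ UA.
exists a => // V aV.
have [//|UnV] := in_ultra_setVsetC (f @^-1` V) UU.
have UnV' : (f @ U) (~` V) by exact: UnV.
by have [x []] := cl_a _ _ UnV' aV.
Qed.

Lemma norm_real_complex (R : rcfType) (x : R) : `|x%:C%C : R[i]| = `|x|%:C%C.
Proof. by rewrite normc_def /= expr0n addr0 sqrtr_sqr. Qed.

Definition heine_borel (C : numFieldType) :=
  forall K : C, compact [set z : C | `|z| <= K].

Lemma complex_heine_borel (R : realType) : heine_borel R[i].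
Proof.
move=> K; rewrite compact_ultra => U UU UK.
have part (f : R[i] -> R) : (forall z, `|f z|%:C%C <= `|z|) ->
    exists a, forall eps, 0 < eps -> U [set z | `|f z - a| < eps].
  move=> fz; pose k := complex.Re K.
  have Uk : U (f @^-1` `[- k, k]).
    apply: (@filterS _ U _ _ _ _ UK) => z /= zK; rewrite in_itv /= -ler_norml -lecR.
    apply: (le_trans (fz z)); apply: (le_trans zK).
    by rewrite RRe_real // ger0_real // (le_trans _ zK).
  have [a _ Ua] := ultra_image_cvg UU (@segment_compact R (- k) k) Uk.
  exists a => eps eps0; have Ub := Ua _ (nbhsx_ballx a _ eps0).
  by apply: (@filterS _ U _ _ _ _ Ub) => z /=; rewrite -ball_normE /ball_ /= distrC.
have Imz (z : R[i]) : `|complex.Im z|%:C%C <= `|z|.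
  have := normc_ge_Re (z * 'i%C); rewrite ReiNIm normrN normrM.
  by rewrite (normCi R[i] : `|'i%C| = 1) mulr1.
have [a Ua] := part _ (@normc_ge_Re R).
have [b Ub] := part _ Imz.
pose p : R[i] := (a +i* b)%C.
have Up eps : 0 < eps -> U [set z | `|p - z| < eps].
  move=> eps0.
  have epsE : eps = (complex.Re eps)%:C%C by rewrite RRe_real // gtr0_real.
  have h0 : 0 < complex.Re eps / 2 by rewrite divr_gt0 // -ltcR -epsE.
  apply: (@filterS _ U _ _ _ _ (filterI (Ua _ h0) (Ub _ h0))) => z [/= za zb].
  have -> : p - z = (a - complex.Re z)%:C%C + 'i * (b - complex.Im z)%:C%C.
    by rewrite /p; case: z {za zb} => x y /=; simpc.
  apply: (le_lt_trans (ler_normD _ _)); rewrite normrM normCi mul1r !norm_real_complex.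
  rewrite -rmorphD epsE ltcR [complex.Re eps]splitr.
  by rewrite distrC [`|b - _|]distrC ltrD.
exists p; split.
  apply/ler_addgt0Pl => eps eps0.
  have [z [/= zK pz]] := filter_ex (filterI UK (Up _ eps0)).
  by rewrite -(subrK z p); apply: (le_trans (ler_normD _ _)); rewrite lerD // ltW.
move=> V; rewrite -nbhs_ballE => -[eps eps0 pV].
by apply: (@filterS _ U _ _ _ _ (Up _ eps0)) => z pz; apply: pV; rewrite -ball_normE.
Qed.

Section CompactOperators.
Context (C : numClosedFieldType) (H : hilbertType C) (T : countType).
Context (dom : pred T) (e : T -> H).
Hypothesis C_proper : heine_borel C.
Hypothesis orth : forall s t, inner (e s) (e t) = ((s == t) && dom t)%:R.

Let norm_proj_le r x : uniq r -> `|\sum_(t <- r) inner (e t) x *: e t| <= `|x|.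
Proof.
move=> ur; rewrite -(@ler_pXn2r _ 2) ?nnegrE // (norm_sum orth) //.
apply: le_trans (bessel orth x ur); rewrite big_mkcond /= ler_sum // => t _.
by case: ifP => // _; rewrite exprn_ge0.
Qed.

Let norm_ket_le t : `|e t| <= 1.
Proof.
by rewrite -(@expr_le1 _ 2) // -inner_norm orth lern1; case: (_ && _).
Qed.

(** Along an ultrafilter on the closure of the image, each coordinate converges by Heine-Borel. The
    uniformly small tails then make the ultrafilter Cauchy. *)
Lemma compact_op_tails (K : H -> H) : bounded_op K ->
  (forall eps : C, 0 < eps -> exists2 r, uniq r & forall x, `|x| <= 1 ->
     `|K x - \sum_(t <- r) inner (e t) (K x) *: e t| <= eps) ->
  compact_op K.
Proof.
move=> bK tails; split; first exact: (proj1 bK).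
set B := K @` _; rewrite compact_ultra => U UU UB.
have [k k0 Kk] := bounded_opP bK.
have B_near y eps : closure B y -> 0 < eps -> exists2 b, B b & `|y - b| < eps.
  move=> /(_ _ (nbhsx_ballx y eps _)) By eps0; have [b [Bb yb]] := By eps0.
  by exists b => //; move: yb; rewrite -ball_normE.
have B_bound y : closure B y -> `|y| <= k + 1.
  move=> /B_near/(_ ltr01) [_ [x /= x1 <-] yx].
  rewrite -(subrK (K x) y) addrC; apply: (le_trans (ler_normD _ _)).
  rewrite lerD // ?(ltW yx) // (le_trans (Kk x)) // -[leRHS]mulr1.
  by rewrite ler_pM2l.
have coord_lim t : exists a, forall eps, 0 < eps -> U [set y | `|inner (e t) y - a| < eps].
  have [|a _ Ua] := @ultra_image_cvg _ _ U (inner (e t)) _ UU (@C_proper (k + 1)).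
    apply: (@filterS _ U _ _ _ _ UB) => y /B_bound yk /=.
    apply: (le_trans (cauchy_schwarz _ _)); rewrite -[leRHS]mul1r.
    by rewrite ler_pM // norm_ket_le.
  exists a => eps eps0; have Ue := Ua _ (nbhsx_ballx a _ eps0).
  apply: (@filterS _ U _ _ _ _ Ue) => y /=.
  by rewrite -ball_normE /ball_ /= distrC.
have [a aU] := choice coord_lim.
have UC : cauchy U.
  apply: cauchy_exP => eps eps0.
  (* Half of [eps] pays for three terms: [y - K x], its projection on the span of [r], and the tail
     of [K x]. The other half is shared by the coordinates in [r]. *)
  have e0 : 0 < eps / 2 / 3 by rewrite !divr_gt0.
  have [r ur rK] := tails _ e0.
  exists (\sum_(t <- r) a t *: e t).
  (* The successor keeps [d] positive for empty [r] and makes [size r] copies of it sum to strictly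
     less than [eps / 2]. *)
  pose d := eps / 2 / (size r).+1%:R.
  have d0 : 0 < d by rewrite !divr_gt0.
  have Ur : U [set y | forall t, t \in r -> `|inner (e t) y - a t| < d].
    elim: (r) => [|t s IH].
      by apply: (@filterS _ U _ _ _ _ UB) => y _ t; rewrite in_nil.
    apply: (@filterS _ U _ _ _ _ (filterI IH (aU t _ d0))) => y [/= ys yt] u.
    by rewrite inE => /orP[/eqP->|us]; [exact: yt|exact: ys].
  apply: (@filterS _ U _ _ _ _ (filterI UB Ur)) => y [/B_near/(_ e0) [_ [x x1 <-] yx] yr].
  rewrite -ball_normE /ball_ /= distrC.
  have -> : y - \sum_(t <- r) a t *: e t =
      (y - K x) + (K x - \sum_(t <- r) inner (e t) (K x) *: e t)
      - (\sum_(t <- r) inner (e t) (y - K x) *: e t)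
      + \sum_(t <- r) (inner (e t) y - a t) *: e t.
    under [X in _ - X + _]eq_bigr do rewrite innerBr scalerBl.
    under [X in _ - _ + X]eq_bigr do rewrite scalerBl.
    rewrite !sumrB opprB.
    set p := \sum_(t <- r) inner _ (K x) *: _; set p' := \sum_(t <- r) inner _ y *: _.
    rewrite [_ + (K x - p)]addrA subrK -!addrA; congr (_ + _).
    by rewrite [- p' + _]addrA addNr add0r !addrA [- p + p]addNr add0r.
  apply: (le_lt_trans (ler_normD _ _)); rewrite [ltRHS]splitr.
  apply: ler_ltD.
    apply: (le_trans (ler_normB _ _)).
    apply: (@le_trans _ _ (eps / 2 / 3 + eps / 2 / 3 + eps / 2 / 3)).
      apply: lerD; last exact: (le_trans (norm_proj_le _ ur) (ltW yx)).
      by apply: (le_trans (ler_normD _ _)); rewrite lerD ?(ltW yx) ?rK.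
    by rewrite le_eqVlt; apply/orP; left; apply/eqP; field.
  apply: (le_lt_trans (ler_norm_sum _ _ _)).
  apply: (@le_lt_trans _ _ (\sum_(t <- r) d)).
    rewrite big_seq [leRHS]big_seq; apply: ler_sum => t tr; rewrite normrZ.
    rewrite -[leRHS]mulr1 ler_pM // ?norm_ket_le //.
    exact/ltW/yr.
  rewrite big_const_seq count_predT iter_addr_0 -[_ *+ size r]mulr_natr /d mulrAC ltr_pdivrMr //.
  by rewrite ltr_pM2l ?divr_gt0 // ltr_nat.
have Up : U --> lim U by exact: cauchy_cvg.
exists (lim U); split => //.
apply: (@closed_closure _ B) => V /Up UV.
exact: (filter_ex (filterI UB UV)).
Qed.

End CompactOperators.

Section CompactResolvent.
Context (C : numClosedFieldType) (H : hilbertType C) (T : countType).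
Context (dom : pred T) (e : T -> H).
Hypothesis C_complete : monotone_complete C.
Hypothesis C_proper : heine_borel C.
Hypothesis orth : forall s t, inner (e s) (e t) = ((s == t) && dom t)%:R.
Hypothesis dense_e : dense (linear_span (e @` [set t | dom t])).

(** Removing the coordinates in [r] leaves a weighted shift whose weights are set to 0 on [r]. *)
Let shift_tail (X : H -> H) (w : T -> C) (tau : T -> T) (eps : C) (r : seq T) x :
  injective tau -> 0 <= eps -> uniq r ->
  (forall t, dom t -> t \notin r -> `|w t| <= eps) ->
  (forall t, dom t -> inner (e t) (X x) = w t * inner (e (tau t)) x) ->
  `|X x - \sum_(t <- r) inner (e t) (X x) *: e t| <= eps * `|x|.
Proof.
move=> tau_inj eps0 ur wr XE.
apply: (norm_le_weighted_shift C_complete orth dense_e (w := fun t => if t \in r then 0 else w t)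
  tau_inj) => // t dt.
  by move=> _; case: ifPn => [_|/wr->//]; rewrite normr0.
rewrite innerBr (coord_sum orth) // dt andbT; case: ifP => _.
  by rewrite subrr mul0r.
by rewrite subr0 XE.
Qed.

(** Both weights of the resolvent are at most [1 / mu t] in modulus, hence at most [eps / 2] off a
    finite set of labels. *)
Lemma diag_compact_resolvent (mu : T -> C) (theta : T -> T) (c : C) :
  involutive theta -> (forall t, dom (theta t) = dom t) ->
  (forall t, mu (theta t) = mu t) -> 0 < c -> (forall t, dom t -> c <= mu t) ->
  (forall eps : C, 0 < eps -> exists r : seq T,
     forall t, dom t -> t \notin r -> (mu t)^-1 <= eps) ->
  exists2 K, is_resolvent (diag_graph dom e mu theta) K & compact_op K.
Proof.
move=> thetaK dom_theta mu_theta c0 cmu mu_tail.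
have [K1 [K2 [bK1 bK2 KR K1E K2E]]] :=
  diag_resolvent_exists C_complete orth dense_e thetaK dom_theta mu_theta c0 cmu.
exists (K1 \+ K2) => //.
apply: (compact_op_tails C_proper orth); first exact: bounded_opD.
move=> eps eps0; have [r0 r0P] := mu_tail _ (divr_gt0 eps0 (ltr0n C 2)).
pose r := undup r0; have ur : uniq r by exact: undup_uniq.
exists r => // x x1.
have e2 : 0 <= eps / 2 by rewrite divr_ge0 // ltW.
have rP t : dom t -> t \notin r -> [/\ 0 < mu t, 0 < mu t ^+ 2 + 1 & (mu t)^-1 <= eps / 2].
  move=> dt; rewrite mem_undup => tr.
  have m0 : 0 < mu t by exact: lt_le_trans (cmu _ dt).
  by split; [|rewrite ltr_wpDl // exprn_ge0 // ltW|exact: r0P].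
have mu_sq t : 0 < mu t -> mu t <= mu t ^+ 2 + 1.
  move=> m0; have [m1|m1] := real_leP (gtr0_real m0) (@real1 C).
    by apply: (le_trans m1); rewrite lerDr exprn_ge0 // ltW.
  by rewrite expr2 -[leLHS]addr0 lerD ?ler01 // -[leLHS]mulr1 ler_pM2l // ltW.
have w1 t : dom t -> t \notin r -> `|mu t / (mu t ^+ 2 + 1)| <= eps / 2.
  move=> dt tr; have [m0 d0 m_eps] := rP _ dt tr.
  rewrite gtr0_norm ?divr_gt0 //; apply: le_trans m_eps.
  rewrite ler_pdivrMr // mulrDr expr2 mulKf ?gt_eqF // mulr1.
  by rewrite lerDl invr_ge0 ltW.
have w2 t : dom t -> t \notin r -> `|- 'i / (mu t ^+ 2 + 1) : C| <= eps / 2.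
  move=> dt tr; have [m0 d0 m_eps] := rP _ dt tr.
  rewrite normrM normrN normCi mul1r normfV gtr0_norm //; apply: le_trans m_eps.
  by rewrite lef_pV2 ?posrE // mu_sq.
have t1 := shift_tail (can_inj thetaK) e2 ur w1 (K1E x).
have t2 := shift_tail (@inj_id T) e2 ur w2 (K2E x).
rewrite /=; under eq_bigr do rewrite innerDr scalerDl.
rewrite big_split /= opprD addrACA; apply: (le_trans (ler_normD _ _)).
rewrite [leRHS]splitr; apply: lerD.
  by apply: (le_trans t1); rewrite -[leRHS]mulr1 ler_wpM2l.
by apply: (le_trans t2); rewrite -[leRHS]mulr1 ler_wpM2l.
Qed.

End CompactResolvent.

(** * Regular operators *)

Section RegularOperators.
Context (C : numClosedFieldType) (H : hilbertType C).
Implicit Types (D P : set (H * H)) (X Y S : H -> H).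

Definition linear_graph D : Prop := D (0, 0) /\
  forall (c : C) x y x' y', D (x, y) -> D (x', y') -> D (c *: x + x', c *: y + y').

Lemma bounded_op0 : bounded_op (fun=> 0 : H).
Proof.
split=> [c x y|]; first by rewrite scaler0 addr0.
by exists 0 => x; rewrite normr0 mul0r.
Qed.

Lemma commutator_id D : is_commutator D id (fun=> 0).
Proof. by split=> [|x y]; [exact: bounded_op0|rewrite addr0]. Qed.

Lemma commutatorM D X Y S S' : bounded_op X -> bounded_op Y ->
  is_commutator D X S -> is_commutator D Y S' ->
  is_commutator D (X \o Y) ((S \o Y) \+ (X \o S')).
Proof.
move=> bX bY [bS XS] [bS' YS']; split.
  by apply: bounded_opD; exact: bounded_opM.
move=> x y /YS'/XS /=.
rewrite -[Y y]scale1r (proj1 bX) !scale1r -addrA; congr (D (_, _ + _)).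
exact: addrC.
Qed.

Section Linear.
Context (D : set (H * H)).
Hypothesis linD : linear_graph D.

Lemma commutatorD X Y S S' : is_commutator D X S -> is_commutator D Y S' ->
  is_commutator D (X \+ Y) (S \+ S').
Proof.
move=> [bS XS] [bS' YS']; split; first exact: bounded_opD.
move=> x y Dxy /=.
have := proj2 linD 1 _ _ _ _ (XS _ _ Dxy) (YS' _ _ Dxy).
by rewrite !scale1r addrACA.
Qed.

Lemma commutatorZ (c : C) X S : is_commutator D X S ->
  is_commutator D (fun x => c *: X x) (fun x => c *: S x).
Proof.
move=> [bS XS]; split; first exact: bounded_opZ.
move=> x y Dxy /=; have := proj2 linD c _ _ _ _ (XS _ _ Dxy) (proj1 linD).
by rewrite !addr0 scalerDr.
Qed.

End Linear.

Lemma dom_delta_bounded P j X : dom_delta P j X -> bounded_op X.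
Proof. by case: j => [|j] []. Qed.

Lemma dom_delta_pred P j X : dom_delta P j.+1 X -> dom_delta P j X.
Proof.
elim: j X => [|j IH] X [bX [S XS dS]]; split => //.
by exists S => //; exact: IH.
Qed.

Lemma dom_delta0 P j : linear_graph P -> dom_delta P j (fun=> 0 : H).
Proof.
move=> linP; elim: j => [|j IH]; split=> //; try exact: bounded_op0.
exists (fun=> 0) => //; split=> [|x y _]; first exact: bounded_op0.
by rewrite addr0; exact: (proj1 linP).
Qed.

Lemma dom_delta_id P j : linear_graph P -> dom_delta P j (@id H).
Proof.
move=> linP; case: j => [|j]; split=> //; try exact: bounded_op_id.
by exists (fun=> 0); [exact: commutator_id|exact: dom_delta0].
Qed.

Lemma dom_deltaD P j X Y : linear_graph P ->
  dom_delta P j X -> dom_delta P j Y -> dom_delta P j (X \+ Y).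
Proof.
move=> linP; elim: j X Y => [|j IH] X Y [bX dX] [bY dY].
  by split => //; exact: bounded_opD.
split; first exact: bounded_opD.
case: dX dY => [S XS dS] [S' YS' dS'].
by exists (S \+ S'); [exact: commutatorD|exact: IH].
Qed.

Lemma dom_deltaZ P j (c : C) X : linear_graph P ->
  dom_delta P j X -> dom_delta P j (fun x => c *: X x).
Proof.
move=> linP; elim: j X => [|j IH] X [bX dX].
  by split => //; exact: bounded_opZ.
split; first exact: bounded_opZ.
case: dX => [S XS dS].
by exists (fun x => c *: S x); [exact: commutatorZ|exact: IH].
Qed.

(** The Leibniz rule places [X] itself next to the commutator of [Y], which is why the induction
    also needs the descent [dom_delta_pred]. *)
Lemma dom_deltaM P j X Y : linear_graph P ->
  dom_delta P j X -> dom_delta P j Y -> dom_delta P j (X \o Y).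
Proof.
move=> linP; elim: j X Y => [|j IH] X Y dX dY.
  by split => //; apply: bounded_opM; apply: dom_delta_bounded; eassumption.
have bX := dom_delta_bounded dX; have bY := dom_delta_bounded dY.
split; first exact: bounded_opM.
case: (dX) (dY) => [_ [S XS dS]] [_ [S' YS' dS']].
exists ((S \o Y) \+ (X \o S')); first exact: commutatorM.
by apply: dom_deltaD => //; apply: IH => //; exact: dom_delta_pred.
Qed.

(** The condition of [regular_triple] on one operator. It is stable under the algebra operations, so
    checking it on generators suffices. *)
Definition regular_op D P X : Prop :=
  OP0 P X /\ exists2 S, is_commutator D X S & OP0 P S.

Section Algebra.
Context (D P : set (H * H)).
Hypotheses (linD : linear_graph D) (linP : linear_graph P).

Lemma regular_op_id : regular_op D P id.
Proof.
split=> [j|]; first exact: dom_delta_id.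
exists (fun=> 0); first exact: commutator_id.
by move=> j; exact: dom_delta0.
Qed.

Lemma regular_opD X Y :
  regular_op D P X -> regular_op D P Y -> regular_op D P (X \+ Y).
Proof.
move=> [oX [S XS oS]] [oY [S' YS' oS']].
split=> [j|]; first exact: dom_deltaD.
by exists (S \+ S') => [|j]; [exact: commutatorD|exact: dom_deltaD].
Qed.

Lemma regular_opZ (c : C) X :
  regular_op D P X -> regular_op D P (fun x => c *: X x).
Proof.
move=> [oX [S XS oS]]; split=> [j|]; first exact: dom_deltaZ.
by exists (fun x => c *: S x) => [|j]; [exact: commutatorZ|exact: dom_deltaZ].
Qed.

Lemma regular_opM X Y :
  regular_op D P X -> regular_op D P Y -> regular_op D P (X \o Y).
Proof.
move=> [oX [S XS oS]] [oY [S' YS' oS']].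
split=> [j|]; first exact: dom_deltaM.
exists ((S \o Y) \+ (X \o S')) => [|j].
  by apply: commutatorM => //;
    [exact: (dom_delta_bounded (oX 0))|exact: (dom_delta_bounded (oY 0))].
by apply: dom_deltaD => //; exact: dom_deltaM.
Qed.

End Algebra.
End RegularOperators.

(** * Finite sums of weighted shifts and their commutators *)

Section BandOperators.
Context (C : numClosedFieldType) (H : hilbertType C) (T : countType).
Context (dom : pred T) (e : T -> H).
Hypothesis C_complete : monotone_complete C.
Hypothesis orth : forall s t, inner (e s) (e t) = ((s == t) && dom t)%:R.
Hypothesis dense_e : dense (linear_span (e @` [set t | dom t])).
Context (n : nat).
Implicit Types (w : 'I_n -> T -> C) (tau : 'I_n -> T -> T) (X : H -> H).

(** A matrix given by rows: row [t] has entry [w k t] in column [tau k t]. In this form composition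
    with [diag_graph] can be computed at every vector of the maximal domain. *)
Definition band w tau X : Prop := forall x t, dom t ->
  inner (e t) (X x) = \sum_(k < n) w k t * inner (e (tau k t)) x.

(** Only transitions inside the index set are bounded: outside it nothing controls [lambda]. *)
Definition bounded_weight (v : T -> C) (sigma : T -> T) : Prop :=
  exists2 K : C, 0 <= K & forall t, dom t -> dom (sigma t) -> `|v t| <= K.

Lemma bounded_weightD v v' sigma : bounded_weight v sigma ->
  bounded_weight v' sigma -> bounded_weight (v \+ v') sigma.
Proof.
move=> [K K0 vK] [L L0 vL]; exists (K + L); first exact: addr_ge0.
by move=> t dt ds; apply: (le_trans (ler_normD _ _)); rewrite lerD ?vK ?vL.
Qed.

Lemma bounded_weightM v v' sigma : bounded_weight v sigma ->
  bounded_weight v' sigma -> bounded_weight (v \* v') sigma.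
Proof.
move=> [K K0 vK] [L L0 vL]; exists (K * L); first exact: mulr_ge0.
by move=> t dt ds /=; rewrite normrM ler_pM // ?vK ?vL.
Qed.

Lemma band_exists w tau : (forall k, injective (tau k)) ->
  (forall k, bounded_weight (w k) (tau k)) ->
  exists2 X, bounded_op X & band w tau X.
Proof.
move=> tau_inj wb.
have ex k : exists X : H -> H, bounded_op X /\
    forall x t, dom t -> inner (e t) (X x) = w k t * inner (e (tau k t)) x.
  have [K K0 wK] := wb k.
  have [X bX XE] := weighted_shift_exists C_complete orth dense_e (@tau_inj k) K0 wK.
  by exists X.
have [Y YE] := choice ex.
exists (fun x => \sum_(k < n) Y k x).
  have E : (fun x => \sum_(k < n) Y k x) = \big[(fun X Y : H -> H => X \+ Y)/(fun=> 0)]_(k < n) Y k.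
    by apply/funext => x; elim/big_rec2: _ => // k Z W _ ->.
  rewrite E; elim/big_ind: _ => [|X Z|k _]; [exact: bounded_op0|exact: bounded_opD|].
  by case: (YE k).
by move=> x t dt; rewrite inner_sumr; apply: eq_bigr => k _; rewrite (proj2 (YE k)).
Qed.

Lemma band_uniq w tau X Y : band w tau X -> band w tau Y -> X = Y.
Proof.
move=> XE YE; apply/funext => x; apply: (coord_inj dense_e) => t dt.
by rewrite XE ?YE.
Qed.

Lemma band_bounded w tau X : (forall k, injective (tau k)) ->
  (forall k, bounded_weight (w k) (tau k)) -> band w tau X -> bounded_op X.
Proof.
by move=> ti wb XE; have [Y bY YE] := band_exists ti wb; rewrite (band_uniq XE YE).
Qed.

Section Commutator.
Context (mu : T -> C) (theta : T -> T).
Hypothesis thetaK : involutive theta.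
Hypothesis dom_theta : forall t, dom (theta t) = dom t.

(** In row [t], D X has weights [mu t * w k (theta t)] and X D has [mu (tau k t) * w k t]. Since
    [tau k] commutes with [theta], both sit in the columns [theta (tau k t)] and can be
    subtracted. *)
Lemma band_commutator w tau X :
  (forall k, injective (tau k)) -> (forall k t, tau k (theta t) = theta (tau k t)) ->
  (forall k, bounded_weight (fun t => mu t * w k (theta t) - mu (tau k t) * w k t) (tau k)) ->
  band w tau X ->
  exists2 S, is_commutator (diag_graph dom e mu theta) X S &
    band (fun k t => mu t * w k (theta t) - mu (tau k t) * w k t)
      (fun k => theta \o tau k) S.
Proof.
move=> tau_inj tau_theta vb XE.
have tau_inj' k : injective (theta \o tau k) by exact: inj_comp (can_inj thetaK) (@tau_inj k).
have vb' k : bounded_weight (fun t => mu t * w k (theta t) - mu (tau k t) * w k t) (theta \o tau k).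
  have [K K0 vK] := vb k; exists K => // t dt /=.
  by rewrite dom_theta; exact: vK.
have [S bS SE] := band_exists tau_inj' vb'.
exists S => //; split=> // x y xy t dt /=.
rewrite innerDr !XE ?dom_theta // SE // -big_split /= mulr_sumr.
apply: eq_bigr => k _; rewrite tau_theta.
have [dk|ndk] := boolP (dom (tau k t)).
  by rewrite (xy (tau k t)) //=; ring.
rewrite [inner (e (tau k t)) y](coord_ndom orth) //.
rewrite [inner (e (theta _)) x](coord_ndom orth) ?dom_theta //.
by rewrite !mulr0 addr0.
Qed.

End Commutator.

Lemma band_OP0 mu w tau X :
  (forall k, injective (tau k)) -> (forall k, bounded_weight (w k) (tau k)) ->
  (forall k, bounded_weight (fun t => mu t - mu (tau k t)) (tau k)) ->
  band w tau X -> OP0 (diag_graph dom e mu id) X.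
Proof.
move=> tau_inj wb mub XE j.
elim: j w X wb XE => [|j IH] w X wb XE; split; try exact: (band_bounded tau_inj wb XE).
- by [].
have vb k : bounded_weight (fun t => mu t * w k t - mu (tau k t) * w k t) (tau k).
  have -> : (fun t => mu t * w k t - mu (tau k t) * w k t) =
      (fun t => mu t - mu (tau k t)) \* w k.
    by apply/funext => t /=; rewrite mulrBl.
  exact: bounded_weightM.
have [S XS SE] := @band_commutator mu id (fun=> erefl) (fun=> erefl) w tau X
  tau_inj (fun _ _ => erefl) vb XE.
by exists S => //; exact: IH SE.
Qed.

Lemma diag_graph_linear mu theta : linear_graph (diag_graph dom e mu theta).
Proof.
split=> [t dt|c x y x' y' xy xy' t dt] /=; first by rewrite !inner0r mulr0.
by rewrite !innerDr !innerZr (xy t) // (xy' t) //= mulrDr mulrCA.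
Qed.

Section Regularity.
Context (mu : T -> C) (theta : T -> T).
Hypothesis thetaK : involutive theta.
Hypothesis dom_theta : forall t, dom (theta t) = dom t.
Hypothesis mu_theta : forall t, mu (theta t) = mu t.
Local Notation P := (diag_graph dom e mu id).
Local Notation D := (diag_graph dom e mu theta).

Lemma band_regular w tau X :
  (forall k, injective (tau k)) -> (forall k t, tau k (theta t) = theta (tau k t)) ->
  (forall k, bounded_weight (w k) (tau k)) ->
  (forall k, bounded_weight (fun t => mu t - mu (tau k t)) (tau k)) ->
  (forall k, bounded_weight (fun t => mu t * w k (theta t) - mu (tau k t) * w k t) (tau k)) ->
  band w tau X -> regular_op D P X.
Proof.
move=> tau_inj tau_theta wb mub vb XE; split; first exact: band_OP0 mub XE.
have [S XS SE] := band_commutator thetaK dom_theta tau_inj tau_theta vb XE.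
exists S => //; apply: (band_OP0 _ _ _ SE) => k.
- exact: inj_comp (can_inj thetaK) (@tau_inj k).
- have [K K0 vK] := vb k; exists K => // t dt /=.
  by rewrite dom_theta; exact: vK.
- have [K K0 vK] := mub k; exists K => // t dt /=.
  by rewrite dom_theta mu_theta; exact: vK.
Qed.

Section AdjointPair.
Context (X X' : H -> H) (w : 'I_n -> T -> C) (sigma sigma' : 'I_n -> T -> T).
Hypothesis adjX : forall x y, inner (X' x) y = inner x (X y).
Hypothesis bX : bounded_op X.
Hypothesis sigmaK : forall k, cancel (sigma k) (sigma' k).
Hypothesis sigmaK' : forall k, cancel (sigma' k) (sigma k).
Hypothesis sigma_sep : forall k l t, sigma k t = sigma l t -> k = l.
Hypothesis sigma_theta : forall k t, sigma k (theta t) = theta (sigma k t).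
Hypothesis w_real : forall k t, w k t \is Num.real.
Hypothesis X_ket : forall t, dom t -> X (e t) = \sum_(k < n) w k t *: e (sigma k t).

(** Row [t] of [X'] is the conjugate of column [t] of [X], and the weights are real. *)
Let adj_band : band w sigma X'.
Proof.
move=> x t dt; rewrite inner_conj adjX -inner_conj X_ket // inner_suml.
by apply: eq_bigr => k _; rewrite innerZl conj_Creal.
Qed.

(** [adj_band] also determines the columns of [X'], and these give the rows of [X]. *)
Let ket_band : band (fun k => w k \o sigma' k) sigma' X.
Proof.
move=> x t dt; rewrite -adjX.
have -> : X' (e t) = \sum_(k < n) w k (sigma' k t) *: e (sigma' k t).
  apply: (coord_inj dense_e) => s ds; rewrite adj_band // inner_sumr.
  apply: eq_bigr => k _; rewrite innerZr !orth dt /=.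
  rewrite (can2_eq (@sigmaK k) (@sigmaK' k)).
  have [<-|] := eqVneq s (sigma' k t); last by rewrite /= !mulr0.
  by rewrite ds.
by rewrite inner_suml; apply: eq_bigr => k _; rewrite innerZl conj_Creal.
Qed.

(** The weight is the matrix entry of [X] at [(sigma k t, t)], hence at most the norm of [X];
    [sigma_sep] prevents two shifts from sharing an entry. *)
Let weight_bounded k : bounded_weight (w k) (sigma k).
Proof.
have [K K0 XK] := bounded_opP bX; exists K; first exact: ltW.
have norm1 t : dom t -> `|e t| = 1.
  by move=> dt; apply/eqP; rewrite -(@pexpr_eq1 _ _ 2) // -inner_norm orth eqxx dt.
move=> t dt ds; have -> : w k t = inner (e (sigma k t)) (X (e t)).
  rewrite X_ket // inner_sumr (bigD1 k) //= innerZr orth eqxx ds mulr1 big1 ?addr0 //.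
  move=> l lk; rewrite innerZr orth; have [/sigma_sep kl|] := eqVneq; last by rewrite mulr0.
  by rewrite kl eqxx in lk.
apply: (le_trans (cauchy_schwarz _ _)); rewrite norm1 // mul1r.
by apply: (le_trans (XK _)); rewrite norm1 // mulr1.
Qed.

Hypothesis mu_step : forall k, bounded_weight (fun t => mu t - mu (sigma k t)) (sigma k).
Hypothesis w_flip : forall k, bounded_weight (fun t => mu t * (w k (theta t) - w k t)) (sigma k).

(** The commutator weight splits into [mu t] times the flip difference of [w k], bounded by
    [w_flip], and a step of [mu] times a bounded weight. *)
Lemma adjoint_pair_regular : regular_op D P X /\ regular_op D P X'.
Proof.
have sigma_theta' k t : sigma' k (theta t) = theta (sigma' k t).
  by rewrite -{1}(sigmaK' k t) -sigma_theta sigmaK.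
have flip_bounded k : bounded_weight (w k \o theta) (sigma k).
  have [K K0 wK] := weight_bounded k; exists K => // t dt ds.
  by apply: wK; rewrite ?sigma_theta dom_theta.
have transfer k v : bounded_weight v (sigma k) -> bounded_weight (v \o sigma' k) (sigma' k).
  by move=> [K K0 vK]; exists K => // t dt ds /=; apply: vK => //; rewrite sigmaK'.
split; last first.
  apply: (band_regular _ _ _ _ _ adj_band) => // k; first exact: can_inj (sigmaK k).
  have -> : (fun t => mu t * w k (theta t) - mu (sigma k t) * w k t) =
     (fun t => mu t * (w k (theta t) - w k t)) \+ (fun t => mu t - mu (sigma k t)) \* w k.
    by apply/funext => t /=; ring.
  by apply: bounded_weightD => //; exact: bounded_weightM.
apply: (band_regular _ _ _ _ _ ket_band) => // k.
- exact: can_inj (sigmaK' k).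
- exact: transfer.
- have -> : (fun t => mu t - mu (sigma' k t)) =
     (fun t => - 1 * (mu t - mu (sigma k t))) \o sigma' k.
    by apply/funext => t /=; rewrite sigmaK' mulN1r opprB.
  apply: transfer; have [K K0 muK] := mu_step k; exists K => // t dt ds.
  by rewrite mulN1r normrN muK.
(* The same splitting in terms of [u = sigma' k t], where [t = sigma k u]; the step of [mu] changes
   sign and multiplies the flipped weight. *)
have -> : (fun t => mu t * (w k \o sigma' k) (theta t) - mu (sigma' k t) * (w k \o sigma' k) t) =
   ((fun t => mu t * (w k (theta t) - w k t)) \+
    (fun t => - 1 * (mu t - mu (sigma k t))) \* (w k \o theta)) \o sigma' k.
  by apply/funext => t /=; rewrite sigmaK' sigma_theta'; ring.
apply: transfer; apply: bounded_weightD => //; apply: bounded_weightM => //.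
have [K K0 muK] := mu_step k; exists K => // t dt ds.
by rewrite mulN1r normrN muK.
Qed.

End AdjointPair.
End Regularity.

End BandOperators.

(** * Estimates of the matrix coefficients *)

(** The Hoelder bound turns a bounded difference of radicands into a bounded difference of roots,
    even where the radicands themselves grow with l. *)
Lemma sqrt_dist (R : rcfType) (x y : R) : 0 <= x -> 0 <= y ->
  `|Num.sqrt x - Num.sqrt y| <= Num.sqrt `|x - y|.
Proof.
wlog xy : x y / y <= x => [hw|] x0 y0.
  by have [/hw|/ltW/hw] := leP y x; [apply|rewrite distrC [`|x - y|]distrC; apply].
rewrite !ger0_norm ?subr_ge0 ?ler_wsqrtr // lerBlDr.
rewrite -(@ler_pXn2r _ 2) ?nnegrE ?addr_ge0 ?sqrtr_ge0 //.
rewrite sqrrD !sqr_sqrtr ?subr_ge0 // addrAC subrK lerDl.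
by rewrite mulrn_wge0 // mulr_ge0 ?sqrtr_ge0.
Qed.

Section QNumbers.
Context (R : realType) (q : R).
Hypothesis q01 : 0 < q < 1.
Local Notation r := (powR q).
Let q0 : 0 < q. Proof. by case/andP: q01. Qed.
Let q1 : q < 1. Proof. by case/andP: q01. Qed.

Lemma qpow_gt0 x : 0 < r x. Proof. exact: powR_gt0. Qed.

Lemma qpow_ge0 x : 0 <= r x. Proof. exact/ltW/qpow_gt0. Qed.

Lemma qpowD x y : r (x + y) = r x * r y.
Proof. by rewrite powRD // (gt_eqF q0) implybT. Qed.

Lemma qpowN x : r (- x) = (r x)^-1. Proof. exact: powRN. Qed.

Lemma qpow1 : r 1 = q. Proof. by rewrite powRr1 // ltW. Qed.

Lemma qpow_le x y : x <= y -> r y <= r x.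
Proof.
move=> xy; rewrite -(subrK x y) qpowD -[leRHS]mul1r ler_pM2r ?qpow_gt0 //.
rewrite /powR (gt_eqF q0) -expR0 ler_expR mulr_ge0_le0 ?subr_ge0 //.
by rewrite ln_le0 // ltW.
Qed.

(** The denominator of [qnum] is negative for [q < 1]; this is its positive form. *)
Definition qscale : R := (q^-1 - q)^-1.

Lemma qscale_gt0 : 0 < qscale.
Proof.
rewrite invr_gt0 subr_gt0 (lt_trans q1) // invf_gt1 //.
Qed.

Lemma qscale_ge0 : 0 <= qscale. Proof. exact/ltW/qscale_gt0. Qed.

Lemma qnumE x : qnum q x = qscale * (r (- x) - r x).
Proof.
rewrite /qnum /qscale -[q - q^-1]opprB invrN mulrN -mulNr opprB mulrC //.
Qed.

Lemma qnum0 : qnum q 0 = 0. Proof. by rewrite qnumE oppr0 subrr mulr0. Qed.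

Lemma qnum_le x : qnum q x <= qscale * r (- x).
Proof. by rewrite qnumE ler_pM2l ?qscale_gt0 // gerDl oppr_le0 ltW ?qpow_gt0. Qed.

Lemma qnum_ge0 x : 0 <= x -> 0 <= qnum q x.
Proof.
move=> x0; rewrite qnumE mulr_ge0 ?qscale_ge0 // subr_ge0 qpow_le //.
by rewrite (le_trans _ x0) // oppr_le0.
Qed.

(** Follows from [r (1 - x) * (q^-1 - q) = r (- x) - r (2 - x)] and [r x <= r (2 - x)]. Together
    with [qnum_le] it shows that [qnum q x] has the order of q^(-x). *)
Lemma qnum_ge x : 1 <= x -> r (1 - x) <= qnum q x.
Proof.
move=> x1; rewrite qnumE mulrC ler_pdivlMr; last first.
  by rewrite -invr_gt0; exact: qscale_gt0.
have xx : r x <= r (2 - x) by apply: qpow_le; lra.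
have -> : r (1 - x) * (q^-1 - q) = r (- x) - r (2 - x).
  have -> : 2 - x = 1 + (1 + - x) by ring.
  rewrite !qpowD qpow1; field; exact: lt0r_neq0.
by rewrite lerD2l lerN2.
Qed.

Lemma qnum_gt0 x : 1 <= x -> 0 < qnum q x.
Proof. by move=> /qnum_ge; apply: lt_le_trans; exact: qpow_gt0. Qed.

Lemma qnum_inv_le x : 1 <= x -> (qnum q x)^-1 <= r (x - 1).
Proof.
move=> x1; rewrite -[x - 1]opprB qpowN lef_pV2 ?posrE ?qpow_gt0 ?qnum_gt0 //.
exact: qnum_ge.
Qed.

(** The second argument may be negative: at [m = l] the coefficient of [x1] contains
    [qnum q (l - m - 1)]. *)
Lemma sqrt_qnum_le x y : 0 <= x ->
  Num.sqrt (qnum q x * qnum q y) <= qscale * r (- (x + y) / 2).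
Proof.
move=> x0; have k0 := qscale_gt0.
have e0 : 0 <= qscale * r (- (x + y) / 2) by rewrite mulr_ge0 ?qpow_ge0 ?qscale_ge0.
rewrite -[leRHS](ger0_norm e0) -sqrtr_sqr ler_wsqrtr //.
have -> : (qscale * r (- (x + y) / 2)) ^+ 2 = (qscale * r (- x)) * (qscale * r (- y)).
  by rewrite exprMn expr2 [r _ ^+ 2]expr2 -qpowD -splitr opprD qpowD mulrACA.
apply: (@le_trans _ _ (qnum q x * (qscale * r (- y)))).
  by rewrite ler_wpM2l ?qnum_ge0 ?qnum_le.
by rewrite ler_wpM2r ?qnum_le // mulr_ge0 ?qpow_ge0 ?qscale_ge0.
Qed.

Section Coefficients.
Context (s N : R).
Hypothesis s01 : 0 <= s <= 1.
Hypothesis N_half : 2^-1 <= `|N|.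

(** One of [|N| + M] and [|N| - M] is 0. Hence nothing is sent below the lowest level [l = |N|]. *)
Lemma alpha_bottom M : M = N \/ M = - N -> podles_alpha q s M `|N| = 0.
Proof.
move=> MN; have E : qnum q (`|N| + M) * qnum q (`|N| - M) = 0.
  by case: MN => ->; case: (ger0P N) => _;
    rewrite ?opprK ?subrr ?addNr ?qnum0 ?mul0r ?mulr0.
by rewrite /podles_alpha -(mulrA (qnum q 2)) E mulr0 mul0r sqrtr0 mulr0 mul0r.
Qed.

(** Only the second radicand changes with the sign of M, and its two values [F] and [F'] differ by
    [(1 - s^4) (q^(2N) - q^(-2N))], which [B0] bounds. *)
Lemma alpha_flip_le : exists2 C, 0 <= C & forall k : nat,
  `|podles_alpha q s N (`|N| + k%:R) - podles_alpha q s (- N) (`|N| + k%:R)|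
    <= C * r (3 * (`|N| + k%:R)).
Proof.
(* From [l+N][l-N] <= qscale^2 q^(-2l) and [2l-1][2l+1] >= q^(2-4l), the first radicand is at most
   [K1 * q^(2l)]. *)
pose K1 := qnum q 2 * qscale ^+ 2 * r (- 2).
pose B0 := r N ^+ 2 + (r N)^-1 ^+ 2.
have n2 : 0 <= qnum q 2 by apply: qnum_ge0; lra.
have K1_ge0 : 0 <= K1.
  by apply: mulr_ge0; [apply: mulr_ge0 => //; exact: sqr_ge0|exact: qpow_ge0].
exists (r (- 1) * Num.sqrt K1 * Num.sqrt B0).
  by rewrite !mulr_ge0 ?sqrtr_ge0 ?qpow_ge0 ?qscale_ge0.
move=> k; set l := `|N| + k%:R.
(* The bottom level is separate because [2l-1] vanishes at l = 1/2; above it l is at least 3/2 and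
   [qnum_ge] bounds the denominator. *)
have [k0|k0] := posnP k.
  rewrite /l k0 addr0 !alpha_bottom; [|by right|by left].
  by rewrite subrr normr0 !mulr_ge0 ?sqrtr_ge0 ?qpow_ge0.
have lM : 0 <= l + N /\ 0 <= l - N.
  by have := ler0n R k; rewrite /l; case: (ger0P N) => N0 ?; split; lra.
rewrite /podles_alpha opprK (mulrAC _ (qnum q (l - N)) (qnum q (l + N))).
set A := _ / _; set F := (_ + _) * (_ * s ^+ 2 + _); set F' := (_ + _) * (_ * s ^+ 2 + _).
rewrite -mulrBr normrM.
have F0 M : 0 <= (r (l + M) + r (- (l + M)) * s ^+ 2) * (r (l - M) * s ^+ 2 + r (- (l - M))).
  have /andP[s0 _] := s01.
  by apply: mulr_ge0; apply: addr_ge0; rewrite ?mulr_ge0 ?sqr_ge0 ?qpow_ge0 //.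
have dF : `|Num.sqrt F - Num.sqrt F'| <= Num.sqrt B0.
  apply: (le_trans (sqrt_dist _ _)); [exact: F0| |].
    by have := F0 (- N); rewrite opprK.
  apply: ler_wsqrtr.
  have -> : F - F' = (1 - s ^+ 4) * (r N ^+ 2 - (r N)^-1 ^+ 2).
    rewrite /F /F' !opprD !opprK !qpowD !qpowN.
    by field; rewrite !gt_eqF ?qpow_gt0.
  have s4 : 0 <= s ^+ 4 <= 1.
    by case/andP: s01 => s0 s1; rewrite exprn_ge0 //= exprn_ile1.
  rewrite normrM -[leRHS]mul1r ler_pM //.
    by case/andP: s4 => s0 s1; rewrite ger0_norm; lra.
  apply: (le_trans (ler_normB _ _)).
  by rewrite !ger0_norm ?sqr_ge0.
have l32 : 3 / 2 <= l.
  by move: k0; rewrite -(ler1n R) /l; move: N_half; lra.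
have AE : A <= K1 * r l ^+ 2.
  have B1 : r (2 - 4 * l) <= qnum q (2 * l - 1) * qnum q (2 * l + 1).
    have -> : 2 - 4 * l = (1 - (2 * l - 1)) + (1 - (2 * l + 1)) by ring.
    by rewrite qpowD ler_pM ?qnum_ge ?qpow_ge0 ?qscale_ge0 //; lra.
  have B0' : 0 < qnum q (2 * l - 1) * qnum q (2 * l + 1).
    by apply: lt_le_trans B1; exact: qpow_gt0.
  rewrite /A ler_pdivrMr //.
  apply: (@le_trans _ _ (K1 * r l ^+ 2 * r (2 - 4 * l))); last first.
    by rewrite ler_wpM2l // mulr_ge0 ?sqr_ge0.
  have -> : K1 * r l ^+ 2 * r (2 - 4 * l) =
      qnum q 2 * (qscale * r (- (l + N))) * (qscale * r (- (l - N))).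
    rewrite /K1; move: (qnum q 2) qscale (l) => n Q x.
    have -> : 2 - 4 * x = 2 + - x + - x + - x + - x by ring.
    rewrite !opprD !opprK !qpowD !qpowN; field.
    by rewrite !gt_eqF ?qpow_gt0.
  rewrite -!(mulrA (qnum q 2)) ler_wpM2l //.
  by case: lM => l1 l2; apply: ler_pM; rewrite ?qnum_le ?qnum_ge0.
have -> : r (- 1) * Num.sqrt K1 * Num.sqrt B0 * r (3 * l) =
    (r (2 * l - 1) * (Num.sqrt K1 * r l)) * Num.sqrt B0.
  have -> : 3 * l = 2 * l + l by ring.
  by rewrite !qpowD; ring.
apply: ler_pM => //; rewrite normrM ler_pM //.
  rewrite ger0_norm ?invr_ge0 ?qnum_inv_le ?qnum_ge0 //; lra.
rewrite ger0_norm ?sqrtr_ge0 // -[r l]ger0_norm ?qpow_ge0 //.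
rewrite -sqrtr_sqr -sqrtrM ?ler_wsqrtr //.
Qed.

(** The identity q^(l+N+1)[l-N] - q^(l-N+1)[l+N] = -q[2N] removes l from the numerator: the
    difference is exactly [G] divided by [2l][2l+2]. *)
Lemma beta_flip_le : exists2 C, 0 <= C & forall k : nat,
  `|podles_beta q s N (`|N| + k%:R) - podles_beta q s (- N) (`|N| + k%:R)|
    <= C * r (3 * (`|N| + k%:R)).
Proof.
pose G := q * qnum q 2 * (qnum q (2 * N) * (1 - s ^+ 2) + 2 * qnum q (2 * N) * s ^+ 2) / q ^+ 2.
exists `|G|; first by [].
move=> k; set l := `|N| + k%:R.
have l12 : 1 / 2 <= l by have := ler0n R k; rewrite /l; move: N_half; lra.
have n1 : 0 < qnum q (2 * l) by apply: qnum_gt0; lra.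
have n2 : 0 < qnum q (2 * l + 2) by apply: qnum_gt0; lra.
have q_neq0 : q != 0 by exact: lt0r_neq0.
have -> : podles_beta q s N l - podles_beta q s (- N) l =
    G * ((qnum q (2 * l))^-1 * (qnum q (2 * l + 2))^-1).
  rewrite /podles_beta /G.
  have E : r (l + N + 1) * qnum q 2 * qnum q (l - N) -
           r (l - N + 1) * qnum q 2 * qnum q (l + N) = - (q * qnum q 2 * qnum q (2 * N)).
    rewrite [qnum q (l - N)]qnumE [qnum q (l + N)]qnumE [qnum q (2 * N)]qnumE.
    have -> : 2 * N = N + N by ring.
    move: (qnum q 2) qscale (l) => n Q x.
    rewrite !opprD !opprK !qpowD !qpowN qpow1; field.
    by rewrite !gt_eqF ?qpow_gt0.
  have E2 : qnum q (2 * - N) = - qnum q (2 * N).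
    by rewrite (mulrN 2) !qnumE opprK; ring.
  rewrite E2 opprK.
  move: E n1 n2; move: (r (l + N + 1) * _ * _) (r (l - N + 1) * _ * _) => x y E.
  have -> : x = y - q * qnum q 2 * qnum q (2 * N) by rewrite -E; ring.
  move=> /lt0r_neq0 n1 /lt0r_neq0 n2.
  by field; rewrite ?n1 ?n2 ?q_neq0.
rewrite normrM ler_wpM2l // ger0_norm; last by rewrite mulr_ge0 // invr_ge0 ltW.
apply: (@le_trans _ _ (r (2 * l - 1) * r (2 * l + 2 - 1))).
  by rewrite ler_pM ?invr_ge0 ?qnum_inv_le ?(ltW n1) ?(ltW n2) //; lra.
by rewrite -qpowD qpow_le //; lra.
Qed.

(** The index [i] stands for the term that changes l by 1 - i; signs are absorbed. *)
Definition x1_coef (i : 'I_3) (M l m : R) : R :=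
  match val i with
  | 0 => r (- l + m) * Num.sqrt (qnum q (l + m + 1) * qnum q (l + m + 2))
         * podles_alpha q s M (l + 1)
  | 1 => - (r (m + 2) * Num.sqrt (qnum q 2 * qnum q (l - m) * qnum q (l + m + 1))
         * podles_beta q s M l)
  | _ => - (r (l + m + 1) * Num.sqrt (qnum q (l - m) * qnum q (l - m - 1))
         * podles_alpha q s M l)
  end.

Definition x0_coef (i : 'I_3) (M l m : R) : R :=
  match val i with
  | 0 => r m * Num.sqrt (qnum q 2 * qnum q (l - m + 1) * qnum q (l + m + 1))
         * podles_alpha q s M (l + 1)
  | 1 => (qnum q (2 * l) - r (l + m + 1) * qnum q 2 * qnum q (l - m))
         * podles_beta q s M l
  | _ => r m * Num.sqrt (qnum q 2 * qnum q (l - m) * qnum q (l + m))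
         * podles_alpha q s M l
  end.

(** The factors in front of alpha and beta do not involve M, so the flip difference is such a factor
    times a difference of alphas or betas. *)
Lemma coef_flip_le : exists2 C, 0 <= C &
  forall (i : 'I_3) (M m : R) (k : nat), let l := `|N| + k%:R in
    M = N \/ M = - N -> - l <= m <= l ->
    `|x1_coef i (- M) l m - x1_coef i M l m| <= C * r l /\
    `|x0_coef i (- M) l m - x0_coef i M l m| <= C * r l.
Proof.
have [Ca Ca0 aC] := alpha_flip_le.
have [Cb Cb0 bC] := beta_flip_le.
have n2 : 0 <= qnum q 2 by apply: qnum_ge0; lra.
(* [c] dominates the constants 1, [2]^(1/2) and 1 + [2] of the prefactors; [r (- 2)] in the final
   constant covers their exponents of q, which are at least -2l - 2. *)
pose c := 1 + Num.sqrt (qnum q 2) + qnum q 2.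
have c0 : 0 <= c by rewrite !addr_ge0 ?sqrtr_ge0.
exists (qscale * c * r (- 2) * (Ca + Cb)).
  rewrite mulr_ge0 ?addr_ge0 // mulr_ge0 ?qpow_ge0 // mulr_ge0 ?qscale_ge0 //.
move=> i M m k l MN /andP[ml lm].
have l12 : 1 / 2 <= l by have := ler0n R k; rewrite /l; move: N_half; lra.
have alphaM : `|podles_alpha q s (- M) l - podles_alpha q s M l| <= (Ca + Cb) * r (3 * l).
  apply: (@le_trans _ _ (Ca * r (3 * l))); last by rewrite ler_wpM2r ?qpow_ge0 ?lerDl.
  by case: MN => ->; [rewrite distrC|rewrite opprK]; exact: aC.
have alphaM1 : `|podles_alpha q s (- M) (l + 1) - podles_alpha q s M (l + 1)|
    <= (Ca + Cb) * r (3 * l).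
  apply: (@le_trans _ _ (Ca * r (3 * (l + 1)))); last first.
    by rewrite ler_pM ?qpow_ge0 ?lerDl // qpow_le //; lra.
  rewrite /l -addrA natr1.
  by case: MN => ->; [rewrite distrC|rewrite opprK]; exact: aC.
have betaM : `|podles_beta q s (- M) l - podles_beta q s M l| <= (Ca + Cb) * r (3 * l).
  apply: (@le_trans _ _ (Cb * r (3 * l))); last by rewrite ler_wpM2r ?qpow_ge0 ?lerDr.
  by case: MN => ->; [rewrite distrC|rewrite opprK]; exact: bC.
have combine p d : `|p| <= qscale * c * r (- 2) * r (- 2 * l) ->
    `|d| <= (Ca + Cb) * r (3 * l) -> `|p * d| <= qscale * c * r (- 2) * (Ca + Cb) * r l.
  move=> pc dc; rewrite normrM; apply: (le_trans (ler_pM _ _ pc dc)) => //.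
  have {3}-> : l = - 2 * l + 3 * l by ring.
  by rewrite qpowD le_eqVlt; apply/orP; left; apply/eqP; ring.
have pref A x : 0 <= A <= c -> - 2 * l - 2 <= x ->
    qscale * A * r x <= qscale * c * r (- 2) * r (- 2 * l).
  move=> /andP[A0 Ac] lx; rewrite -(mulrA (qscale * c)) -qpowD.
  apply: ler_pM; rewrite ?mulr_ge0 ?qscale_ge0 ?qpow_ge0 ?ler_wpM2l ?qscale_ge0 //.
  by rewrite qpow_le //; lra.
have one_c : 0 <= (1 : R) <= c by rewrite ler01 /c -addrA lerDl addr_ge0 ?sqrtr_ge0.
have sqrt_c : 0 <= Num.sqrt (qnum q 2) <= c.
  by rewrite sqrtr_ge0 /c addrAC lerDr addr_ge0.
have pos_norm x y : 0 <= x -> `|r y * x| = r y * x.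
  by move=> x0; rewrite ger0_norm // mulr_ge0 ?qpow_ge0.
have sqrt2 x y z : 0 <= x -> r z * Num.sqrt (qnum q 2 * qnum q x * qnum q y) <=
    qscale * Num.sqrt (qnum q 2) * r (z - (x + y) / 2).
  move=> x0; rewrite -mulrA sqrtrM // [z - _]addrC qpowD -mulNr.
  have -> : qscale * Num.sqrt (qnum q 2) * (r (- (x + y) / 2) * r z) =
    r z * (Num.sqrt (qnum q 2) * (qscale * r (- (x + y) / 2))) by ring.
  by rewrite !ler_wpM2l ?qpow_ge0 ?sqrtr_ge0 ?sqrt_qnum_le.
have sqrt1 x y z : 0 <= x -> r z * Num.sqrt (qnum q x * qnum q y) <=
    qscale * 1 * r (z - (x + y) / 2).
  move=> x0; rewrite [z - _]addrC qpowD -mulNr mulr1.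
  have -> : qscale * (r (- (x + y) / 2) * r z) =
    r z * (qscale * r (- (x + y) / 2)) by ring.
  by rewrite ler_wpM2l ?qpow_ge0 ?sqrt_qnum_le.
case: i => -[|[|[|//]]] i3; rewrite /x1_coef /x0_coef /=; split.
- rewrite -mulrBr; apply: combine => //; rewrite pos_norm ?sqrtr_ge0 //.
  by apply: (le_trans (sqrt1 _ _ _ _)); [lra|apply: pref => //; lra].
- rewrite -mulrBr; apply: combine => //; rewrite pos_norm ?sqrtr_ge0 //.
  by apply: (le_trans (sqrt2 _ _ _ _)); [lra|apply: pref => //; lra].
- rewrite -opprD normrN -mulrBr; apply: combine => //; rewrite pos_norm ?sqrtr_ge0 //.
  by apply: (le_trans (sqrt2 _ _ _ _)); [lra|apply: pref => //; lra].
- rewrite -mulrBr; apply: combine => //.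
  apply: (le_trans (ler_normB _ _)); rewrite !ger0_norm ?qnum_ge0 //; last 2 first.
  + by apply: mulr_ge0; [exact: mulr_ge0 (qpow_ge0 _) n2|apply: qnum_ge0; lra].
  + lra.
  apply: (@le_trans _ _ (qscale * (1 + qnum q 2) * r (- 2 * l))); last first.
    apply: pref; last by lra.
    by rewrite addr_ge0 //= /c addrAC lerDl sqrtr_ge0.
  have -> : qscale * (1 + qnum q 2) * r (- 2 * l) =
     qscale * r (- (2 * l)) + qscale * qnum q 2 * r (- 2 * l).
    by rewrite mulrDr mulr1 mulrDl mulNr.
  rewrite lerD ?qnum_le //.
  (* The powers of q combine to exponent 2m + 1, which is at least -2l. *)
  apply: (@le_trans _ _ (r (l + m + 1) * qnum q 2 * (qscale * r (- (l - m))))).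
    by apply: ler_wpM2l; [exact: mulr_ge0 (qpow_ge0 _) n2|exact: qnum_le].
  have -> : r (l + m + 1) * qnum q 2 * (qscale * r (- (l - m))) =
      qscale * qnum q 2 * r (l + m + 1 - (l - m)) by rewrite [r (_ - _)]qpowD; ring.
  apply: ler_wpM2l; first exact: mulr_ge0 qscale_ge0 n2.
  by apply: qpow_le; lra.
- rewrite -opprD normrN -mulrBr; apply: combine => //; rewrite pos_norm ?sqrtr_ge0 //.
  by apply: (le_trans (sqrt1 _ _ _ _)); [lra|apply: pref => //; lra].
- rewrite -mulrBr; apply: combine => //; rewrite pos_norm ?sqrtr_ge0 //.
  by apply: (le_trans (sqrt2 _ _ _ _)); [lra|apply: pref => //; lra].
Qed.

(** By Bernoulli, q^(-k) is at least [1 + k (q^-1 - 1)], and the constant is chosen so that its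
    product with this dominates [mu 0 + k |K|]. *)
Lemma linear_growth_qpow (mu : nat -> R) (K : R) :
  (forall k, 0 <= mu k) -> (forall k, mu k.+1 - mu k <= K) ->
  exists2 C, 0 <= C & forall k, mu k * r (`|N| + k%:R) <= C.
Proof.
move=> mu0 muK.
have muk k : mu k <= mu 0%N + k%:R * `|K|.
  elim: k => [|k IH]; first by rewrite mul0r addr0.
  rewrite -natr1 mulrDl mul1r addrA -lerBlDr; apply: le_trans IH.
  by rewrite lerBlDr -lerBlDl (le_trans (muK k)) // ler_norm.
have q1' : 0 < q^-1 - 1 by rewrite subr_gt0 invf_gt1.
have bern k : 1 + k%:R * (q^-1 - 1) <= q^-1 ^+ k.
  elim: k => [|k IH]; first by rewrite mul0r addr0.
  rewrite exprS -natr1.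
  have p0 : 0 <= q^-1 by rewrite invr_ge0 ltW.
  apply: le_trans (ler_wpM2l p0 IH); rewrite -subr_ge0.
  have -> : q^-1 * (1 + k%:R * (q^-1 - 1)) - (1 + (k%:R + 1) * (q^-1 - 1)) =
    k%:R * (q^-1 - 1) ^+ 2 by move: (q^-1) => p; ring.
  by rewrite mulr_ge0 ?sqr_ge0.
exists (mu 0%N + `|K| / (q^-1 - 1)).
  by rewrite addr_ge0 // divr_ge0 // ltW.
move=> k.
have rk : r (`|N| + k%:R) <= (q^-1 ^+ k)^-1.
  rewrite qpowD powR_mulrn ?(ltW q0) // exprVn invrK -[leRHS]mul1r.
  rewrite ler_wpM2r ?exprn_ge0 ?(ltW q0) //.
  by rewrite -(powRr0 q) qpow_le.
have qk0 : 0 < q^-1 ^+ k by rewrite exprn_gt0 ?invr_gt0.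
apply: (le_trans (ler_wpM2l (mu0 k) rk)); rewrite ler_pdivrMr //.
apply: (le_trans (muk k)).
apply: (@le_trans _ _ ((mu 0%N + `|K| / (q^-1 - 1)) * (1 + k%:R * (q^-1 - 1)))); last first.
  by rewrite ler_wpM2l ?bern // addr_ge0 // divr_ge0 // ltW.
have -> : (mu 0%N + `|K| / (q^-1 - 1)) * (1 + k%:R * (q^-1 - 1)) =
   mu 0%N + k%:R * `|K| + (mu 0%N * (k%:R * (q^-1 - 1)) + `|K| / (q^-1 - 1)).
  move: q1' => /lt0r_neq0; move: (q^-1 - 1) => p p0; field; exact: p0.
rewrite lerDl addr_ge0 ?divr_ge0 ?(ltW q1') //.
by apply: mulr_ge0 => //; apply: mulr_ge0 (ler0n _ _) (ltW q1').
Qed.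

End Coefficients.
End QNumbers.

(** * The algebra of the sphere *)

Section PodlesRelations.
Context (R : realType) (q s : R) (H : hilbertType R[i]) (pi : podles q s -> H -> H).
Hypothesis pi_rep : star_representation pi.

Lemma rep0 x : pi 0 x = 0.
Proof.
case: pi_rep => _ add _ _ _.
have := add 1 0 0 x; rewrite scale1r addr0 scale1r => /eqP.
by rewrite -subr_eq subrr eq_sym => /eqP.
Qed.

Lemma repZ c a x : pi (c *: a) x = c *: pi a x.
Proof. by case: pi_rep => _ add _ _ _; have := add c a 0 x; rewrite rep0 !addr0. Qed.

Lemma repD a b x : pi (a + b) x = pi a x + pi b x.
Proof. by case: pi_rep => _ add _ _ _; have := add 1 a b x; rewrite !scale1r. Qed.

(** Indexing by terms makes the relations available as the constructors of [podles_cong]. *)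
Definition term_op (t : podles_term R) : H -> H := pi (\pi_(podles q s) t)%qT.

Lemma term_op_cong t u : podles_cong q s t u -> term_op t = term_op u.
Proof. by move=> tu; congr pi; apply/podles_eqP. Qed.

Lemma term_op_linear t : linear (term_op t).
Proof. by case: pi_rep => lin _ _ _ _; exact: lin. Qed.

Lemma term_op_add t u x : term_op (padd t u) x = term_op t x + term_op u x.
Proof.
by rewrite /term_op -podles_addE; exact: repD.
Qed.

Lemma term_op_mul t u x : term_op (pmul t u) x = term_op t (term_op u x).
Proof. by case: pi_rep => _ _ _ mul _; rewrite /term_op -podles_mulE; exact: mul. Qed.

Lemma term_op_scalar c x : term_op (pscalar c) x = c *: x.
Proof.
case: pi_rep => _ _ one _ _; rewrite -[in RHS](one x) -repZ.
by congr (pi _ x); exact/esym/podles_mulr1.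
Qed.

Lemma term_op_star t x y : inner (term_op (pstar t) x) y = inner x (term_op t y).
Proof. by case: pi_rep => _ _ _ _ adj; rewrite /term_op -podles_starE; exact: adj. Qed.

Lemma term_op_star_r t x y : inner x (term_op (pstar t) y) = inner (term_op t x) y.
Proof. by rewrite inner_conj term_op_star -inner_conj. Qed.

Lemma term_opA_sym x y : inner (term_op pgenA x) y = inner x (term_op pgenA y).
Proof. by rewrite [in LHS](term_op_cong (pc_A_star _ _)) term_op_star. Qed.

Hypotheses (q01 : 0 < q < 1) (s01 : 0 <= s <= 1).

Lemma podles_norm_le x :
  [/\ `|term_op pgenA x| <= `|x|, `|term_op pgenB x| <= `|x| &
      `|term_op (pstar pgenB) x| <= `|x|].
Proof.
have normE (y : H) : exists2 a : R, `|y| = a%:C%C & 0 <= a.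
  have /RRe_real E : `|y| \is Num.real by rewrite normr_real.
  by exists (complex.Re `|y|) => //; rewrite -ler0c E.
have [b bE b0] := normE x.
have [a aE a0] := normE (term_op pgenA x).
have [c cE c0] := normE (term_op pgenB x).
have [d dE d0] := normE (term_op (pstar pgenB) x).
pose t := complex.Re (inner x (term_op pgenA x)).
have tE : inner x (term_op pgenA x) = t%:C%C.
  rewrite RRe_real // CrealE; apply/eqP.
  by rewrite -inner_conj term_opA_sym.
have t_le : t <= a * b.
  apply: (le_trans (ler_norm _)); rewrite -lecR rmorphM /= -aE -bE mulrC.
  rewrite -norm_real_complex -tE; exact: cauchy_schwarz.
have eq1 : d ^+ 2 + (a ^+ 2 - t + s ^+ 2 * (t - b ^+ 2)) = 0.
  apply: (@complexI R).
  have := term_op_cong (pc_BBs q s) => /(congr1 (fun f => inner x (f x))).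
  rewrite !(term_op_add, term_op_mul, term_op_scalar) scale0r inner0r.
  rewrite !(innerDr, innerZr) -term_op_star inner_norm dE.
  rewrite -[inner x (term_op pgenA (_ + _))]term_opA_sym innerDr innerZr inner_norm term_opA_sym.
  rewrite inner_norm tE aE bE => E; rewrite [RHS]rmorph0 -[RHS]E.
  by rewrite !(rmorphD, rmorphN, rmorphM, rmorphXn) /=; ring.
have eq2 : c ^+ 2 + (q ^+ 4 * a ^+ 2 - q ^+ 2 * t + s ^+ 2 * (q ^+ 2 * t - b ^+ 2)) = 0.
  apply: (@complexI R).
  have := term_op_cong (pc_BsB q s) => /(congr1 (fun f => inner x (f x))).
  rewrite !(term_op_add, term_op_mul, term_op_scalar) scale0r inner0r.
  rewrite !(innerDr, innerZr) term_op_star_r inner_norm cE.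
  rewrite -[inner x (term_op pgenA (_ + _))]term_opA_sym innerDr !innerZr inner_norm term_opA_sym.
  rewrite inner_norm tE aE bE => E; rewrite [RHS]rmorph0 -[RHS]E.
  by rewrite !(rmorphD, rmorphN, rmorphM, rmorphXn) /=; ring.
have s2 : 0 <= s ^+ 2 <= 1.
  by case/andP: s01 => s0 s1; rewrite sqr_ge0 expr_le1.
have q2 : 0 <= q ^+ 2 <= 1.
  by case/andP: q01 => q0 q1; rewrite sqr_ge0 expr_le1 ?ltW.
have ab : a <= b.
  (* If [b < a], then [t <= a * b] makes the bracket in [eq1] at least [(a - b) (a + s^2 b) > 0],
     which is impossible as [d^2 >= 0]. *)
  rewrite leNgt; apply/negP => ba.
  have : 0 < (a - b) * (a + s ^+ 2 * b).
    rewrite mulr_gt0 ?subr_gt0 // ltr_wpDr ?(le_lt_trans b0) //.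
    by rewrite mulr_ge0 // sqr_ge0.
  have : (1 - s ^+ 2) * t <= (1 - s ^+ 2) * (a * b).
    by rewrite ler_wpM2l // subr_ge0; case/andP: s2.
  have := sqr_ge0 d; move: eq1; nra.
have t_b : t <= b ^+ 2.
  by apply: (le_trans t_le); rewrite expr2 ler_wpM2r.
have tb1 : (1 - s ^+ 2) * t <= (1 - s ^+ 2) * b ^+ 2.
  by rewrite ler_wpM2l // subr_ge0; case/andP: s2.
have d2 : d ^+ 2 <= b ^+ 2 by have := sqr_ge0 a; move: eq1; lra.
have c2 : c ^+ 2 <= b ^+ 2.
  have h1 : q ^+ 2 * ((1 - s ^+ 2) * t) <= q ^+ 2 * ((1 - s ^+ 2) * b ^+ 2).
    by rewrite ler_wpM2l ?sqr_ge0.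
  have h2 : q ^+ 2 * ((1 - s ^+ 2) * b ^+ 2) <= 1 * ((1 - s ^+ 2) * b ^+ 2).
    by rewrite ler_wpM2r ?mulr_ge0 ?sqr_ge0 ?subr_ge0 //; [case/andP: s2|case/andP: q2].
  have h3 : 0 <= q ^+ 4 * a ^+ 2 by rewrite mulr_ge0 ?sqr_ge0 // exprn_ge0 // ltW; case/andP: q01.
  by move: eq2 h1 h2 h3; lra.
rewrite aE bE cE dE !lecR ab -(@ler_pXn2r _ 2) ?nnegrE // -[d <= b](@ler_pXn2r _ 2) ?nnegrE //.
Qed.

Lemma podles_bounded : [/\ bounded_op (term_op pgenA), bounded_op (term_op pgenB) &
  bounded_op (term_op (pstar pgenB))].
Proof.
by split; (split; [exact: term_op_linear|]); exists 1 => x; rewrite mul1r;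
  have [] := podles_norm_le x.
Qed.

(* Closure under the involution is not needed: in every term the star can be
   pushed down to the generators. *)
Lemma podles_op_ind (Q : (H -> H) -> Prop) :
  Q id -> (forall X Y, Q X -> Q Y -> Q (X \+ Y)) -> (forall c X, Q X -> Q (fun x => c *: X x)) ->
  (forall X Y, Q X -> Q Y -> Q (X \o Y)) ->
  Q (term_op pgenA) -> Q (term_op pgenB) -> Q (term_op (pstar pgenB)) ->
  forall a, Q (pi a).
Proof.
move=> Q1 QD QZ QM QA QB QB'.
have Qs c : Q (term_op (pscalar c)).
  have -> : term_op (pscalar c) = (fun x => c *: id x).
    by apply/funext => x; rewrite term_op_scalar.
  exact: QZ.
have Qadd t u : Q (term_op t) -> Q (term_op u) -> Q (term_op (padd t u)).
  move=> Qt Qu; have -> : term_op (padd t u) = term_op t \+ term_op u.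
    by apply/funext => x; rewrite term_op_add.
  exact: QD.
have Qmul t u : Q (term_op t) -> Q (term_op u) -> Q (term_op (pmul t u)).
  move=> Qt Qu; have -> : term_op (pmul t u) = term_op t \o term_op u.
    by apply/funext => x; rewrite term_op_mul.
  exact: QM.
have all t : Q (term_op t) /\ Q (term_op (pstar t)).
  elim: t => [||c|t [Qt Qt'] u [Qu Qu']|t [Qt Qt'] u [Qu Qu']|t [Qt Qt']].
  - by rewrite -(term_op_cong (pc_A_star _ _)).
  - by [].
  - by rewrite (term_op_cong (pc_star_scalar _ _ _)).
  - by rewrite (term_op_cong (pc_starD _ _ _ _)); split; exact: Qadd.
  - by rewrite (term_op_cong (pc_starM _ _ _ _)); split; exact: Qmul.
  - by rewrite (term_op_cong (pc_starK _ _ _)).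
by elim/podles_ind => t; case: (all t).
Qed.

End PodlesRelations.

(** * Integer labels for the basis vectors *)

Section Kets.
Context (R : realType) (N : R).
Hypothesis N0 : N != 0.

(* The label (b, k, j) stands for M = N or -N, l = |N| + k and m = -l + j, so
   that the shifts of l and m become translations of the pair (k, j). *)
Definition label : countType := (bool * int * int)%type.

Definition ket_M (t : label) : R := if t.1.1 then N else - N.
Definition ket_l (t : label) : R := `|N| + t.1.2%:~R.
Definition ket_m (t : label) : R := - ket_l t + t.2%:~R.
Definition ket_of (t : label) : R * R * R := (ket_M t, ket_l t, ket_m t).
Definition ket_dom : pred label := fun t => `[< ket_index N (ket_of t) >].
Definition flip (t : label) : label := (~~ t.1.1, t.1.2, t.2).
(** As [m = - l + j], this adds [a] to l, [b - a] to m and [b] to l + m. *)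
Definition shift (a b : int) (t : label) : label := (t.1.1, t.1.2 + a, t.2 + b).

Lemma ket_of_inj : injective ket_of.
Proof.
move=> [[b k] j] [[b' k'] j'] [].
rewrite /ket_m /ket_l /ket_M /= => EM /addrI/intr_inj ->.
move=> /addrI/intr_inj ->; congr (_, _, _).
have NN : N <> - N.
  by move/eqP; rewrite eq_sym -subr_eq0 -opprD oppr_eq0 -mulr2n mulrn_eq0 (negPf N0).
by case: b b' EM => [] [] // /esym.
Qed.

Lemma flipK : involutive flip.
Proof. by move=> [[b k] j]; rewrite /flip /= negbK. Qed.

Lemma ket_M_flip t : ket_M (flip t) = - ket_M t.
Proof. by rewrite /ket_M /=; case: (t.1.1); rewrite ?opprK. Qed.

Lemma ket_domP t : ket_dom t <-> exists2 k : nat, t.1.2 = k & exists2 j : nat, t.2 = j &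
  ket_m t <= ket_l t.
Proof.
split=> [/asboolP [_ [k lk] [j mj] ml]|[k tk [j tj ml]]].
  exists k; first by move: lk => /addrI; rewrite -[k%:R]/(k%:~R) => /intr_inj.
  by exists j => //; move: mj => /addrI; rewrite -[j%:R]/(j%:~R) => /intr_inj.
apply/asboolP; split=> //.
- by rewrite /ket_M; case: (t.1.1); [left|right].
- by exists k; rewrite /ket_l tk.
- by exists j; rewrite /ket_m tj.
Qed.

Lemma ket_dom_flip t : ket_dom (flip t) = ket_dom t.
Proof.
by apply/idP/idP => /ket_domP dt; apply/ket_domP; move: dt; rewrite /ket_m /ket_l.
Qed.

Lemma ket_of_onto p : ket_index N p -> exists2 t, ket_dom t & ket_of t = p.
Proof.
case: p => -[M l] m pN; case: (pN) => MN [k lk] [j mj] ml.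
exists (M == N, k : int, j : int); last first.
  rewrite /ket_of /ket_M /ket_m /ket_l /= -lk -mj.
  by case: MN => ->; rewrite ?eqxx //; case: eqP => // ->.
apply/ket_domP; exists k => //; exists j => //.
by rewrite /ket_m /ket_l /= -lk -mj.
Qed.

Lemma shiftK a b : cancel (shift a b) (shift (- a) (- b)).
Proof. by move=> [[c k] j]; rewrite /shift /= !addrK. Qed.

Lemma shiftNK a b : cancel (shift (- a) (- b)) (shift a b).
Proof. by move=> [[c k] j]; rewrite /shift /= !subrK. Qed.

Lemma ket_of_shift a b t : ket_of (shift a b t) =
  (ket_M t, ket_l t + a%:~R, ket_m t + (b - a)%:~R).
Proof.
rewrite /ket_of /ket_m /ket_l /= !intrD; congr (_, _, _); first by rewrite addrA.
by rewrite rmorphN /=; ring.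
Qed.

End Kets.

(** * The spectral triple of the Podles sphere *)

Section Main.
Context (R : realType) (q s N : R) (lambda : R -> R).
Context (H : hilbertType R[i]) (ket : R * R * R -> H).
Context (pi : podles q s -> H -> H) (gamma : H -> H).
Hypothesis q01 : 0 < q < 1.
Hypothesis s01 : 0 <= s <= 1.
Hypothesis N_half : half_integer N.
Hypothesis N0 : N != 0.
Hypothesis ketB : orthonormal_basis (ket_index N) ket.
Hypothesis pi_podles : is_podles_representation N ket pi.
Hypothesis gamma_grading : is_grading N ket gamma.
Hypothesis lambda_gt0 : forall k : nat, 0 < lambda (`|N| + k%:R).
Hypothesis lambda_cvg : lambda (`|N| + k%:R) @[k --> \oo] --> +oo.
Context (K : R).
Hypothesis lambda_step : forall k : nat,
  `|lambda (`|N| + k%:R + 1) - lambda (`|N| + k%:R)| <= K.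

Let C : numClosedFieldType := R[i].
Let dom := ket_dom N.
Let e (t : label) : H := if dom t then ket (ket_of N t) else 0.
Let mu (t : label) : C := (lambda (ket_l N t))%:C%C.

Let eE t : dom t -> e t = ket (ket_of N t).
Proof. by rewrite /e => ->. Qed.

Let e_out t : ~~ dom t -> e t = 0.
Proof. by rewrite /e => /negPf ->. Qed.

Lemma N_ge_half : 2^-1 <= `|N|.
Proof.
have [z Nz] := N_half.
have z0 : z != 0.
  apply: contra_neq N0 => z0; move: Nz; rewrite z0 mulr0z => /eqP.
  by rewrite mulf_eq0 pnatr_eq0 /= => /eqP.
have : (1 : R) <= `|z%:~R|.
  by rewrite -intr_norm -[1]/(1%:~R) ler_int -gtz0_ge1 normr_gt0.
by rewrite -Nz normrM ger0_norm //; lra.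
Qed.

Let orth t u : inner (e t) (e u) = ((t == u) && dom u)%:R.
Proof.
have [du|/e_out ->] := boolP (dom u); last by rewrite inner0r andbF.
have [dt|ndt] := boolP (dom t); last first.
  rewrite e_out // inner0l andbT; case: eqP => // tu; by rewrite tu du in ndt.
rewrite !eE // (proj1 ketB) ?andbT; [|exact/asboolP|exact/asboolP].
by rewrite (inj_eq (ket_of_inj N0)).
Qed.

Let dense_e : dense (linear_span (e @` [set t | dom t])).
Proof.
have -> : e @` [set t | dom t] = ket @` ket_index N; last exact: (proj2 ketB).
apply/seteqP; split=> x [].
  by move=> t dt <-; exists (ket_of N t); [exact/asboolP|rewrite eE].
by move=> p /ket_of_onto [t dt <-] <-; exists t; rewrite // eE.
Qed.

Let complete := @complex_monotone_complete R.
Let D := diag_graph dom e mu flip.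
Let P := diag_graph dom e mu id.

Let mu_nat t : dom t -> exists2 k : nat, t.1.2 = k & mu t = (lambda (`|N| + k%:R))%:C%C.
Proof. by move=> /ket_domP [k tk _]; exists k; rewrite // /mu /ket_l tk. Qed.

Let mu_flip t : mu (flip t) = mu t. Proof. by []. Qed.

(** Divergence puts all but finitely many [lambda_l] above 1; a minimum takes care of the others. *)
Let mu_lower : exists2 c : C, 0 < c & forall t, dom t -> c <= mu t.
Proof.
have [n0 _ n0P] := (cvgryPge _).1 lambda_cvg 1.
have [c c0 cP] : exists2 c, 0 < c & forall k, (k < n0)%N -> c <= lambda (`|N| + k%:R).
  elim: n0 {n0P} => [|n [c c0 cP]]; first by exists 1.
  exists (Num.min c (lambda (`|N| + n%:R))); first by rewrite lt_min c0 lambda_gt0.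
  move=> k; rewrite ltnS leq_eqVlt => /orP[/eqP->|/cP ck].
    by rewrite ge_min lexx orbT.
  by rewrite ge_min ck.
exists (Num.min c 1)%:C%C; first by rewrite -[0]/(0%:C%C) ltcR lt_min c0 ltr01.
move=> t /mu_nat [k _ ->]; rewrite lecR ge_min.
by have [/cP->//|/n0P /= ->] := ltnP k n0; rewrite orbT.
Qed.

Let mu_step a : (`|a| <= 1)%N -> forall b,
  bounded_weight dom (fun t => mu t - mu (shift a b t)) (shift a b).
Proof.
move=> a1 b; exists `|K|%:C%C; first by rewrite ler0c.
move=> t /mu_nat [k tk ->] /mu_nat [k' tk' ->].
rewrite -rmorphB norm_real_complex lecR.
have step n : `|lambda (`|N| + n.+1%:R) - lambda (`|N| + n%:R)| <= `|K|.
  by rewrite -natr1 addrA (le_trans (lambda_step n)) // ler_norm.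
have : [\/ k' = k.+1, k' = k | k = k'.+1].
  move: tk' => /=; rewrite tk; case: a a1 => [[|[|a]]|[|a]] // _.
  - by rewrite addr0 => -[->]; exact: Or32.
  - by rewrite -[_ + _]/(Posz (k + 1)) addn1 => -[<-]; exact: Or31.
  - case: k {tk} => [|k] //; rewrite NegzE subzSS subr0 => -[->]; exact: Or33.
by case=> ->; rewrite ?subrr ?normr0 // distrC.
Qed.

Let linD := diag_graph_linear dom e mu flip.
Let linP := diag_graph_linear dom e mu id.

Section Generators.
Context (X X' : H -> H) (w : 'I_3 -> R -> R -> R -> R) (a b : 'I_3 -> int).
Hypothesis adjX : forall x y, inner (X' x) y = inner x (X y).
Hypothesis bX : bounded_op X.
Hypothesis a1 : forall i, (`|a i| <= 1)%N.
Hypothesis a_inj : injective a.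
Hypothesis X_ket : forall t, dom t -> X (e t) =
  \sum_(i < 3) (w i (ket_M N t) (ket_l N t) (ket_m N t))%:C%C *: e (shift (a i) (b i) t).
Context (c : R).
Hypothesis w_flip : forall (i : 'I_3) (M m : R) (k : nat), let l := `|N| + k%:R in
  M = N \/ M = - N -> - l <= m <= l -> `|w i (- M) l m - w i M l m| <= c * q `^ l.

Lemma generator_regular : regular_op D P X /\ regular_op D P X'.
Proof.
pose v i t : C := (w i (ket_M N t) (ket_l N t) (ket_m N t))%:C%C.
apply: (@adjoint_pair_regular _ _ _ dom e complete orth dense_e 3 mu flip flipK (@ket_dom_flip _ N)
  (fun=> erefl) X X' v (fun i => shift (a i) (b i)) (fun i => shift (- a i) (- b i))) => //.
- by move=> i; exact: shiftK.
- by move=> i; exact: shiftNK.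
- by move=> i j t [/addrI/a_inj].
- by move=> i t; apply/complex_realP; eexists.
- by move=> i; exact: mu_step.
move=> i.
have lam_ge0 k : 0 <= lambda (`|N| + k%:R) by exact/ltW/lambda_gt0.
have lam_step k : lambda (`|N| + k.+1%:R) - lambda (`|N| + k%:R) <= K.
  by rewrite -natr1 addrA (le_trans (ler_norm _)) // lambda_step.
have [c' c'0 lam_le] := linear_growth_qpow q01 N lam_ge0 lam_step.
exists (c' * `|c|)%:C%C; first by rewrite ler0c mulr_ge0.
move=> t dt _; have [k tk muE] := mu_nat dt.
have [_ _ [j tj ml]] := (ket_domP N t).1 dt.
have lE : ket_l N t = `|N| + k%:R by rewrite /ket_l tk.
rewrite muE /v ket_M_flip -rmorphB -rmorphM norm_real_complex lecR normrM ger0_norm //.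
apply: (@le_trans _ _ (lambda (`|N| + k%:R) * (`|c| * q `^ (`|N| + k%:R)))).
  rewrite ler_wpM2l //; apply: (@le_trans _ _ (c * q `^ (`|N| + k%:R))); last first.
    by rewrite ler_wpM2r ?powR_ge0 ?ler_norm.
  have -> : ket_l N (flip t) = ket_l N t by [].
  have -> : ket_m N (flip t) = ket_m N t by [].
  rewrite lE; apply: w_flip; first by rewrite /ket_M; case: (t.1.1); [left|right].
  by rewrite -lE ml andbT /ket_m lerDl tj.
by rewrite mulrCA mulrC ler_wpM2r.
Qed.

End Generators.

(** In the coordinates k, j = l + m and p = l - m the index set is the octant of natural numbers; p
    is an integer because 2N is. A shift lowers p by [b - 2 a]. *)
Let dom_coords t : dom t -> exists k j p : nat,
  [/\ ket_l N t = `|N| + k%:R, ket_l N t + ket_m N t = j%:R, ket_l N t - ket_m N t = p%:R &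
    forall a b : int, - a <= k%:Z -> - b <= j%:Z -> b - a *+ 2 <= p%:Z -> dom (shift a b t)].
Proof.
move=> /ket_domP [k tk [j tj ml]]; have [z Nz] := N_half.
have N2 : 2 * `|N| = (`|z|%N%:Z)%:~R by rewrite -pmulrn natr_absz intr_norm -Nz normrM ger0_norm.
have lmE : ket_l N t - ket_m N t = (`|z|%:Z + k%:Z *+ 2 - j%:Z)%:~R.
  by rewrite /ket_m /ket_l tk tj !(rmorphD, rmorphN, rmorphMn) /= -N2; ring.
pose p : int := `|z|%:Z + k%:Z *+ 2 - j%:Z.
have p0 : 0 <= p by rewrite -(ler0z R) -lmE subr_ge0.
exists k, j, (absz p); split.
- by rewrite /ket_l tk.
- by rewrite /ket_m tj addrA subrr add0r.
- by rewrite natr_absz ger0_norm.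
rewrite gez0_abs // => a b ka jb pab; apply/ket_domP.
have ka0 : 0 <= k%:Z + a by rewrite -lerBlDr sub0r.
have jb0 : 0 <= j%:Z + b by rewrite -lerBlDr sub0r.
exists (absz (k%:Z + a)); first by rewrite /= tk gez0_abs.
exists (absz (j%:Z + b)); first by rewrite /= tj gez0_abs.
rewrite -subr_ge0; have -> : ket_l N (shift a b t) - ket_m N (shift a b t) =
    (p - (b - a *+ 2))%:~R.
  rewrite /p /ket_m /ket_l /= tk tj !(rmorphD, rmorphN, rmorphMn) /= -N2; ring.
by rewrite ler0z subr_ge0.
Qed.

(* [ket \_ _] takes the value [point] outside the index set, which is not known
   to be 0; this is harmless since the coefficients vanish there. *)
Let ket_term t a b (c : R) : (~~ dom (shift a b t) -> c = 0) ->
  c%:C%C *: (ket \_ (ket_index N)) (ket_of N (shift a b t)) = c%:C%C *: e (shift a b t).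
Proof.
have [dt _|_ ->//] := boolP (dom (shift a b t)); last by rewrite !scale0r.
by rewrite eE // patchT // inE; exact/asboolP.
Qed.

Let x1_ket t : dom t -> pi (podles_x1 q s) (e t) =
  \sum_(i < 3) (x1_coef q s i (ket_M N t) (ket_l N t) (ket_m N t))%:C%C *:
    e (shift (1 - i%:Z) (2 - i%:Z) t).
Proof.
move=> dt; have [k [j [p [lk lj lp dom_shift]]]] := dom_coords dt.
have MN : ket_M N t = N \/ ket_M N t = - N.
  by rewrite /ket_M; case: (t.1.1); [left|right].
have /asboolP dt' := dt; have [x1E _] := (proj2 pi_podles) _ _ _ dt'.
rewrite eE // x1E !big_ord_recl big_ord0 addr0 addrA /x1_coef /= /bump /=.
set M := ket_M N t in MN *; set l := ket_l N t in lk lj lp *.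
set m := ket_m N t in lj lp *.
have ketE (a b : int) l' m' : l' = l + a%:~R -> m' = m + (b - a)%:~R ->
    (M, l', m') = ket_of N (shift a b t) by move=> -> ->; rewrite ket_of_shift.
rewrite (ketE 1 2) // (ketE 0 1) ?addr0 // (ketE (- 1) 0) //.
rewrite !rmorphN !scaleNr !ket_term ?addrA //.
(* The lowering term leaves the index set at k = 0, where alpha vanishes, or when l - m is 0 or 1,
   where [l-m][l-m-1] vanishes. *)
- move=> nd.
  have [k0|k0] := posnP k; first by rewrite lk k0 addr0 alpha_bottom // mulr0.
  suff -> : qnum q (l - m) * qnum q (l - m - 1) = 0 by rewrite sqrtr0 mulr0 mul0r.
  rewrite lp; case: p lp dom_shift => [|[|p]] lp dom_shift;
    rewrite ?qnum0 ?mul0r // ?subrr ?qnum0 ?mulr0 //.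
  by case/negP: nd; apply: dom_shift; rewrite ?opprK //; lia.
- move=> nd.
  suff -> : qnum q (l - m) = 0 by rewrite mulr0 mul0r sqrtr0 mulr0 mul0r.
  rewrite lp; case: p lp dom_shift => [|p] lp dom_shift; rewrite ?qnum0 //.
  by case/negP: nd; apply: dom_shift; lia.
- by move=> nd; case/negP: nd; apply: dom_shift; lia.
Qed.

Let x0_ket t : dom t -> pi (podles_x0 q s) (e t) =
  \sum_(i < 3) (x0_coef q s i (ket_M N t) (ket_l N t) (ket_m N t))%:C%C *:
    e (shift (1 - i%:Z) (1 - i%:Z) t).
Proof.
move=> dt; have [k [j [p [lk lj lp dom_shift]]]] := dom_coords dt.
have MN : ket_M N t = N \/ ket_M N t = - N.
  by rewrite /ket_M; case: (t.1.1); [left|right].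
have /asboolP dt' := dt; have [_ x0E] := (proj2 pi_podles) _ _ _ dt'.
rewrite eE // x0E !big_ord_recl big_ord0 addr0 /x0_coef /= /bump /=.
set M := ket_M N t in MN *; set l := ket_l N t in lk lj lp *.
set m := ket_m N t in lj lp *.
have ketE (a : int) l' : l' = l + a%:~R ->
    (M, l', m) = ket_of N (shift a a t).
  by move=> ->; rewrite ket_of_shift subrr addr0.
rewrite (ketE 1) // (ketE 0) ?addr0 // (ketE (- 1)) //.
rewrite !ket_term //.
- exact: esym (addrA _ _ _).
(* Here the exits are k = 0, killed by alpha, and l - m = 0 or l + m = 0, killed by [l-m][l+m]. *)
- move=> nd.
  have [k0|k0] := posnP k; first by rewrite lk k0 addr0 alpha_bottom // mulr0.
  suff E : qnum q (l - m) * qnum q (l + m) = 0.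
    by rewrite -(mulrA (qnum q 2)) E mulr0 sqrtr0 mulr0 mul0r.
  rewrite lp lj; case: p lp dom_shift => [|p] lp dom_shift; rewrite ?qnum0 ?mul0r //.
  case: j lj dom_shift => [|j] lj dom_shift; rewrite ?qnum0 ?mulr0 //.
  by case/negP: nd; apply: dom_shift; lia.
- by move=> nd; case/negP: nd; apply: dom_shift; lia.
- by move=> nd; case/negP: nd; apply: dom_shift; lia.
Qed.

(** * From x_0 and x_1 to all operators of the algebra *)

Let pi_rep : star_representation pi := proj1 pi_podles.
Local Notation opA := (term_op pi (@pgenA R)).
Local Notation opB := (term_op pi (@pgenB R)).
Local Notation opB' := (term_op pi (pstar (@pgenB R))).

Let q2_gt0 : 0 < q * qnum q 2.
Proof.
by rewrite mulr_gt0 ?(qnum_gt0 q01) //; [case/andP: q01|lra].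
Qed.

Let x1_scale : C := (Num.sqrt (q * qnum q 2))%:C%C.
Let x0_scale : C := (q * qnum q 2)%:C%C.

Let x1_scale_neq0 : x1_scale != 0.
Proof. by rewrite /x1_scale fmorph_eq0 gt_eqF // sqrtr_gt0. Qed.

Let x0_scale_neq0 : x0_scale != 0.
Proof. by rewrite /x0_scale fmorph_eq0 gt_eqF. Qed.

Let x1_op x : pi (podles_x1 q s) x = x1_scale *: opB x.
Proof. exact: (repZ pi_rep). Qed.

Let x1_star_op x : pi (star (podles_x1 q s)) x = x1_scale *: opB' x.
Proof.
rewrite /podles_x1 starZ (repZ pi_rep) conj_Creal; last by apply/complex_realP; eexists.
by congr (_ *: pi _ x); exact: podles_starE.
Qed.

Let x0_op x : pi (podles_x0 q s) x = (1 - s ^+ 2)%:C%C *: x - x0_scale *: opA x.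
Proof.
case: pi_rep => _ _ one _ _.
rewrite /podles_x0 (repD pi_rep) -scaleN1r !(repZ pi_rep) one.
by congr (_ + _); exact: scaleN1r.
Qed.

Let opB_E : opB = fun x => x1_scale^-1 *: pi (podles_x1 q s) x.
Proof. by apply/funext => x; rewrite x1_op scalerA mulVf // scale1r. Qed.

Let opB'_E : opB' = fun x => x1_scale^-1 *: pi (star (podles_x1 q s)) x.
Proof. by apply/funext => x; rewrite x1_star_op scalerA mulVf // scale1r. Qed.

Let opA_E : opA = fun x => x0_scale^-1 *:
  ((1 - s ^+ 2)%:C%C *: id x + - 1 *: pi (podles_x0 q s) x).
Proof.
apply/funext => x; rewrite x0_op scaleN1r opprB addrC subrK.
by rewrite scalerA mulVf // scale1r.
Qed.

Let rep_adj a x y : inner (pi (star a) x) y = inner x (pi a y).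
Proof. by case: pi_rep. Qed.

Let x1_bounded : bounded_op (pi (podles_x1 q s)).
Proof.
have [_ bB _] := podles_bounded pi_rep q01 s01.
rewrite (_ : pi _ = fun x => x1_scale *: opB x); first exact: bounded_opZ.
by apply/funext => x; exact: x1_op.
Qed.

Let x0_bounded : bounded_op (pi (podles_x0 q s)).
Proof.
have [bA _ _] := podles_bounded pi_rep q01 s01.
rewrite (_ : pi _ = (fun x => (1 - s ^+ 2)%:C%C *: x) \+ (fun x => - x0_scale *: opA x)).
  by apply: bounded_opD; apply: bounded_opZ => //; exact: bounded_op_id.
by apply/funext => x; rewrite x0_op /= scaleNr.
Qed.

Lemma rep_regular a : regular_op D P (pi a).
Proof.
have [c c0 cP] := coef_flip_le q01 s01 N_ge_half.
have a1 (i : 'I_3) : (`|1 - i%:Z| <= 1)%N by case: i => -[|[|[|]]].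
have a_inj : injective (fun i : 'I_3 => 1 - i%:Z).
  by move=> i j /addrI/oppr_inj [] ij; exact: val_inj.
have [r1 r1'] := @generator_regular (pi (podles_x1 q s)) (pi (star (podles_x1 q s)))
  (x1_coef q s) (fun i => 1 - i%:Z) (fun i => 2 - i%:Z) (rep_adj _) x1_bounded a1 a_inj x1_ket c
  (fun i M m k hM hm => proj1 (cP i M m k hM hm)).
have [r0 _] := @generator_regular (pi (podles_x0 q s)) (pi (star (podles_x0 q s)))
  (x0_coef q s) (fun i => 1 - i%:Z) (fun i => 1 - i%:Z) (rep_adj _) x0_bounded a1 a_inj x0_ket c
  (fun i M m k hM hm => proj2 (cP i M m k hM hm)).
apply: (podles_op_ind pi_rep).
- exact: regular_op_id.
- by move=> X Y; exact: regular_opD.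
- by move=> k X; exact: regular_opZ.
- by move=> X Y; exact: regular_opM.
- rewrite opA_E; apply: (regular_opZ linD linP).
  apply: (regular_opD linD linP (X := fun x => (1 - s ^+ 2)%:C%C *: id x)
    (Y := fun x => - 1 *: pi (podles_x0 q s) x)); apply: regular_opZ => //.
  exact: regular_op_id.
- by rewrite opB_E; exact: regular_opZ.
- by rewrite opB'_E; exact: regular_opZ.
Qed.

(** * The grading *)

Let sgn (t : label) : C := if t.1.1 then - 1 else 1.

Let sgn_real t : (sgn t)^* = sgn t.
Proof. by rewrite /sgn; case: ifP => _; rewrite ?rmorphN rmorph1. Qed.

Let gamma_ket t : dom t -> gamma (e t) = sgn t *: e t.
Proof.
move=> dt; rewrite eE //.
have dN : ket_index N (N, ket_l N t, ket_m N t).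
  by have /asboolP [_ kl jm ml] := dt; split => //; left.
have [gN gP] := (proj2 gamma_grading) _ _ dN.
rewrite /ket_of /ket_M /sgn; case: ifP => _; first by rewrite gP scaleN1r.
by rewrite gN scale1r.
Qed.

Let gamma_bounded : bounded_op gamma := proj1 gamma_grading.

Let gamma_sym x y : inner (gamma x) y = inner x (gamma y).
Proof.
apply: (bounded_op_adj dense_e) => // t u dt du.
rewrite !gamma_ket // innerZl innerZr !orth sgn_real.
by have [->|] := eqVneq t u; rewrite //= !mulr0.
Qed.

Let gamma_coord t x : dom t -> inner (e t) (gamma x) = sgn t * inner (e t) x.
Proof. by move=> dt; rewrite -gamma_sym gamma_ket // innerZl sgn_real. Qed.

Let gammaK x : gamma (gamma x) = x.
Proof.
apply: (coord_inj dense_e) => t dt; rewrite !gamma_coord // mulrA.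
by rewrite /sgn; case: ifP => _; rewrite ?mulrNN mulr1 mul1r.
Qed.

(** Shifts keep the sign bit of a label, so [gamma] acts by one and the same sign on [e t] and on
    every term of [X (e t)]. *)
Let gamma_comm_gen X (w : 'I_3 -> label -> C) (a b : 'I_3 -> int) : bounded_op X ->
  (forall t, dom t -> X (e t) = \sum_(i < 3) w i t *: e (shift (a i) (b i) t)) ->
  forall x, gamma (X x) = X (gamma x).
Proof.
move=> bX XE.
apply: (bounded_op_eq dense_e (X := gamma \o X) (Y := X \o gamma)); try exact: bounded_opM.
move=> t dt /=; rewrite gamma_ket //.
rewrite (linear_opZ (proj1 bX)) XE // (linear_op_sum (proj1 gamma_bounded)) scaler_sumr.
apply: eq_bigr => i _; rewrite !scalerA.
have [ds|/e_out ->] := boolP (dom (shift (a i) (b i) t)); last first.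
  by rewrite (linear_op0 (proj1 gamma_bounded)) !scaler0.
by rewrite gamma_ket // scalerA mulrC.
Qed.

Let gamma_comm a x : gamma (pi a x) = pi a (gamma x).
Proof.
have g1 := gamma_comm_gen x1_bounded x1_ket.
have g0 := gamma_comm_gen x0_bounded x0_ket.
have gZ := linear_opZ (proj1 gamma_bounded).
have gD := linear_opD (proj1 gamma_bounded).
have gB y : gamma (opB y) = opB (gamma y) by rewrite opB_E gZ g1.
apply: (podles_op_ind pi_rep (Q := fun X => forall x, gamma (X x) = X (gamma x))) => //.
- by move=> X Y gX gY y; rewrite /= gD gX gY.
- by move=> c X gX y; rewrite gZ gX.
- by move=> X Y gX gY y; rewrite /= gX gY.
- by move=> y; rewrite opA_E gZ gD !gZ g0.
(* For the adjoint of B, move it and the symmetric [gamma] to the other side of the inner product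
   and use [gB]. *)
move=> y; apply: (coord_inj dense_e) => t dt.
by rewrite -gamma_sym !(term_op_star_r pi_rep) -gB gamma_sym.
Qed.

(** * The Dirac operator, its modulus and its resolvent *)

Let D_sa : self_adjoint D.
Proof.
have [c c0 cmu] := mu_lower.
exact: (diag_self_adjoint complete orth dense_e flipK (@ket_dom_flip _ N) mu_flip c0 cmu).
Qed.

Let P_abs : is_abs_op D P.
Proof.
have [c c0 cmu] := mu_lower; split.
- exact: (diag_self_adjoint complete orth dense_e (theta := id)
    (fun=> erefl) (fun=> erefl) (fun=> erefl) c0 cmu).
- exact: (diag_positive complete orth dense_e c0 cmu).
- rewrite (proj2 D_sa).
  exact: (diag_comp_abs complete orth dense_e flipK (@ket_dom_flip _ N) mu_flip).
Qed.

Let D_resolvent : exists2 K, is_resolvent D K & compact_op K.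
Proof.
have [c c0 cmu] := mu_lower.
apply: (diag_compact_resolvent complete (@complex_heine_borel R) orth dense_e flipK
  (@ket_dom_flip _ N) mu_flip c0 cmu) => eps eps0.
have epsE : eps = (complex.Re eps)%:C%C by rewrite RRe_real // gtr0_real.
have e0 : 0 < complex.Re eps by rewrite -ltcR -epsE.
have [n0 _ n0P] := (cvgryPge _).1 lambda_cvg (complex.Re eps)^-1.
(* For [k < n0] the index [j = l + m] is at most 2l, hence below [J]: finitely many labels have
   [lambda_l] below [1 / eps]. *)
pose J := Num.bound (2 * (`|N| + n0%:R)).
exists [seq ((bk.1, Posz bk.2), Posz j) |
  bk <- [seq (b, k) | b <- [:: true; false], k <- iota 0 n0], j <- iota 0 J].
move=> t dt; apply: contraNT => t_small.
have [k [j [p [lk lj lp _]]]] := dom_coords dt.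
have [k' tk muE] := mu_nat dt.
have kk' : k' = k.
  by move: lk; rewrite /ket_l tk => /addrI/eqP; rewrite eqr_nat => /eqP.
have tj : t.2 = j.
  by move: lj; rewrite /ket_m addrA subrr add0r => /eqP; rewrite -[j%:R]/(j%:~R) eqr_int => /eqP.
move: t_small; rewrite muE epsE -fmorphV lecR -[leRHS]invrK lef_pV2 ?posrE ?invr_gt0 // kk'.
have [kn _|/n0P/= ->//] := ltnP k n0.
apply/allpairsP; exists ((t.1.1, k), j); split.
- by apply/allpairsP; exists (t.1.1, k); split; rewrite /= ?mem_iota ?kn //; case: (t.1.1).
- rewrite mem_iota /= add0n -(ltr_nat R) /J.
  have jl : j%:R <= 2 * (`|N| + n0%:R) :> R.
    have : k%:R <= n0%:R :> R by rewrite ler_nat ltnW.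
    by have := ler0n R p; rewrite -lp -lj; move: lk => ->; lra.
  apply: (le_lt_trans jl); apply: archi_boundP.
  by rewrite mulr_ge0 // addr_ge0.
- by rewrite -kk' -tk -tj; case: (t) => -[].
Qed.

(** Testing a self-adjoint [D'] against the kets yields the equations of [D], so [D'] is contained
    in [D]. Passing to adjoints reverses the inclusion. *)
Lemma dirac_unique : unique (is_dirac N ket lambda) D.
Proof.
have [c c0 cmu] := mu_lower.
have flip_label t : dom t -> e (flip t) = ket (- ket_M N t, ket_l N t, ket_m N t).
  move=> dt; rewrite eE; last by rewrite /dom ket_dom_flip.
  by rewrite /ket_of ket_M_flip.
split.
  split=> [|M l m /ket_of_onto [t dt [<- <- <-]]]; first exact: D_sa.
  have := diag_graph_ket orth flipK (@ket_dom_flip _ N) mu_flip dt.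
  by rewrite flip_label // eE.
move=> D' [D'_sa D'_ket].
have sub : D' `<=` D.
  move=> [x y] Dxy t dt /=.
  have : adjoint D' (x, y) by rewrite (proj2 D'_sa).
  have /asboolP kt := dt; move=> /(_ _ _ (D'_ket _ _ _ kt)) /=.
  rewrite -[ket (- _, _, _)]flip_label // -[ket _]eE // innerZr => /(congr1 (fun z => z^*)).
  by rewrite rmorphM /= -!inner_conj conj_Creal //; apply/complex_realP; eexists.
apply/seteqP; split => // p; rewrite -{1}(proj2 D_sa) => Dp.
by rewrite -(proj2 D'_sa) => x y /sub; exact: Dp.
Qed.

Lemma podles_regular_triple : regular_even_spectral_triple pi D gamma.
Proof.
split; last first.
  exists P => // a; exact: rep_regular.
split; first split.
- exact: pi_rep.
- by move=> a; have [oa _] := rep_regular a; exact: (dom_delta_bounded (oa 0%N)).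
- exact: D_sa.
- exact: D_resolvent.
- by move=> a; have [_ [S aS _]] := rep_regular a; exists S.
split => // x y Dxy t dt /=.
have /= Dt := Dxy t dt; have dt' : dom (flip t) by rewrite /dom ket_dom_flip.
rewrite innerNr !gamma_coord // Dt -mulNr mulrCA; congr (_ * (_ * _)).
by rewrite /sgn /=; case: (t.1.1); rewrite ?opprK.
Qed.

Lemma dirac_regular_triple : exists D : set (H * H),
  unique (is_dirac N ket lambda) D /\ regular_even_spectral_triple pi D gamma.
Proof. by exists D; split; [exact: dirac_unique|exact: podles_regular_triple]. Qed.

End Main.

Theorem proposition3p8 (R : realType) (q s N : R) (lambda : R -> R)
    (H : hilbertType R[i]) (ket : R * R * R -> H)
    (pi : podles q s -> H -> H) (gamma : H -> H) :
  0 < q < 1 -> 0 <= s <= 1 -> half_integer N -> N != 0 ->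
  orthonormal_basis (ket_index N) ket ->
  is_podles_representation N ket pi ->
  is_grading N ket gamma ->
  (forall k : nat, 0 < lambda (`|N| + k%:R)) ->
  lambda (`|N| + k%:R) @[k --> \oo] --> +oo ->
  (exists K : R, forall k : nat,
    `|lambda (`|N| + k%:R + 1) - lambda (`|N| + k%:R)| <= K) ->
  exists D : set (H * H),
    unique (is_dirac N ket lambda) D /\
    regular_even_spectral_triple pi D gamma.
Proof.
move=> q01 s01 N_half N0 ketB pi_podles gamma_grading lambda_gt0 lambda_cvg [K lambda_step].
exact: (dirac_regular_triple q01 s01 N_half N0 ketB pi_podles gamma_grading
  lambda_gt0 lambda_cvg lambda_step).
Qed.
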